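(* Let $\mathbb{K}$ be a number field, let $U:\mathbb{Z}\to\mathbb{K}$ be a linear recurrence sequence, let $\mathfrak{p}$ be a prime of $\mathbb{K}$ regular for $U$, with $p$ the rational prime below $\mathfrak{p}$, and let $a\in\mathbb{Q}$. Assume there exists a sequence of integers $(n_k)$ with $\nu_{\mathfrak{p}}(U(n_k))\to+\infty$ and $\nu_p(n_k-a)\to+\infty$. Then $a$ is a twisted rational zero of $U$.
   Context: A $\mathbb{K}$-valued linear recurrence sequence is a map $U:\mathbb{Z}\to\mathbb{K}$ with $U(n+m)=a_{m-1}U(n+m-1)+\dots+a_0U(n)$ for all $n$, $a_i\in\mathbb{K}$, $a_0\ne0$, $m$ minimal. With $\lambda_1,\dots,\lambda_s\in\overline{\mathbb{K}}$ the distinct roots of $X^m-a_{m-1}X^{m-1}-\dots-a_0$, $U(n)=\sum_{i=1}^s f_i(n)\lambda_i^n$ with nonzero polynomials $f_i$ (Binet expansion). For $a=k/\ell$ in lowest terms with $\ell>0$, a determination of $\lambda_i^a$ is $\mu^k$ with $\mu^\ell=\lambda_i$. $a\in\mathbb{Q}$ is a twisted rational zero of $U$ if for some determinations of $\lambda_i^a$ and some roots of unity $\xi_i$ we have $\sum_{i=1}^s\xi_if_i(a)\lambda_i^a=0$. A prime $\mathfrak{p}$ of $\mathbb{K}$ is regular for $U$ if $a_0,\dots,a_{m-1}$ are $\mathfrak{p}$-adic integers and $a_0$ is a $\mathfrak{p}$-adic unit. $\nu_{\mathfrak{p}}$ is the normalized $\mathfrak{p}$-adic valuation; $\nu_p$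 is the $p$-adic valuation on $\mathbb{Q}$. *)

(* Defs.v *)
From HB Require Import structures.
From mathcomp Require Import all_boot all_order all_algebra all_field.
From mathcomp Require Import boolp classical_sets constructive_ereal.

Set Implicit Arguments.
Unset Strict Implicit.
Unset Printing Implicit Defensive.

Import Order.TTheory GRing.Theory Num.Theory.
Local Open Scope ring_scope.
Local Open Scope classical_set_scope.

Definition algebraic_integer (K : fieldExtType rat) : {pred K} :=
  fun x => `[< integralOver (intr : int -> K) x >].

Lemma algebraic_integer_subring (K : fieldExtType rat) :
  subring_closed (@algebraic_integer K).
Proof.
split=> [|x y /asboolP xI /asboolP yI|x y /asboolP xI /asboolP yI];
  apply/asboolP.
- exact: integral1.
- exact: integral_sub.
- exact: integral_mul.
Qed.

HB.instance Definition _ (K : fieldExtType rat) :=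
  GRing.isSubringClosed.Build K (@algebraic_integer K)
    (@algebraic_integer_subring K).

Record ring_of_integers (K : fieldExtType rat) := RingOfIntegers {
  roi_val : K;
  roi_valP : roi_val \in @algebraic_integer K }.

HB.instance Definition _ (K : fieldExtType rat) :=
  [isSub for @roi_val K].
HB.instance Definition _ (K : fieldExtType rat) :=
  [Choice of ring_of_integers K by <:].
HB.instance Definition _ (K : fieldExtType rat) :=
  [SubChoice_isSubComNzRing of ring_of_integers K by <:].

(* Membership in the n-th power of the ideal I; the coefficients c matter only
   for n = 0, where they make I^0 the whole ring. *)
Definition ideal_power (R : comNzRingType) (I : {pred R}) (n : nat) : set R :=
  [set x | exists (m : nat) (c : 'I_m -> R) (y : 'I_m -> 'I_n -> R),
    (forall i j, y i j \in I) /\ x = \sum_(i < m) c i * \prod_(j < n) y i j].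

Record number_field_prime (K : fieldExtType rat) := NumberFieldPrime {
  nfp_ideal :> prime_idealr (ring_of_integers K);
  nfp_neq0 : exists2 x, x \in nfp_ideal & x != 0 }.

(* The exponents picked by xget here and in prime_valuation exist and are unique
   for nonzero x, by unique factorization of ideals. *)
Definition integer_valuation (K : fieldExtType rat)
    (P : number_field_prime K) (x : ring_of_integers K) : nat :=
  xget 0%N [set n | ideal_power P n x /\ ~ ideal_power P n.+1 x].

Definition prime_valuation (K : fieldExtType rat)
    (P : number_field_prime K) (x : K) : \bar int :=
  if x == 0 then +oo%E else
  EFin (xget 0 [set v : int | exists y z : ring_of_integers K,
     [/\ y != 0, z != 0, x = val y / val z &
         v = (integer_valuation P y)%:Z - (integer_valuation P z)%:Z]]).

Definition padic_valuation (p : nat) (x : rat) : \bar int :=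
  if x == 0 then +oo%E else
  EFin ((logn p `|numq x|%N)%:Z - (logn p `|denq x|%N)%:Z).

Definition tends_to_infty (u : nat -> \bar int) : Prop :=
  forall M : int, exists N : nat, forall k : nat, (N <= k)%N -> (M%:E <= u k)%E.

Definition satisfies_recurrence (K : fieldType) (U : int -> K)
    (m : nat) (a : 'I_m -> K) : Prop :=
  forall n : int, U (n + m%:Z) = \sum_(i < m) a i * U (n + i%:Z).

(* Order 0 is allowed, and then there is no a_0: by minimality this is exactly
   the case of the zero sequence, whose Binet expansion is the empty sum. *)
Record linear_recurrence (K : fieldType) := LinearRecurrence {
  lrs_seq :> int -> K;
  lrs_order : nat;
  lrs_coef : 'I_lrs_order -> K;
  lrs_coef0 : forall i, nat_of_ord i = 0%N -> lrs_coef i != 0;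
  lrs_rec : satisfies_recurrence lrs_seq lrs_coef;
  lrs_min : forall (m : nat) (a : 'I_m -> K),
    (forall i, nat_of_ord i = 0%N -> a i != 0) ->
    satisfies_recurrence lrs_seq a -> (lrs_order <= m)%N }.

Definition lrs_poly (K : fieldType) (U : linear_recurrence K) : {poly K} :=
  'X^(lrs_order U) - \sum_(i < lrs_order U) lrs_coef i *: 'X^i.

Definition regular_prime (K : fieldExtType rat) (U : linear_recurrence K)
    (P : number_field_prime K) : Prop :=
  (forall i : 'I_(lrs_order U), (0%:E <= prime_valuation P (lrs_coef i))%E) /\
  (forall i : 'I_(lrs_order U), nat_of_ord i = 0%N ->
     prime_valuation P (lrs_coef i) = 0%:E%E).

Definition is_algebraic_closure (K : fieldType) (L : closedFieldType)
    (iota : {rmorphism K -> L}) : Prop :=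
  forall x : L, algebraicOver iota x.

Definition binet_expansion (K : fieldType) (L : closedFieldType)
    (iota : {rmorphism K -> L}) (U : linear_recurrence K)
    (s : nat) (lam : 'I_s -> L) (f : 'I_s -> {poly L}) : Prop :=
  [/\ injective lam,
      forall x : L,
        root (map_poly iota (lrs_poly U)) x <-> exists i, x = lam i,
      forall i, f i != 0 &
      forall n : int, iota (U n) = \sum_(i < s) (f i).[n%:~R] * lam i ^ n].

(* denq a > 0, and numq a, denq a are coprime. *)
Definition determination (L : fieldType) (l : L) (a : rat) (x : L) : Prop :=
  exists mu : L, mu ^ denq a = l /\ x = mu ^ numq a.

Definition is_root_of_unity (L : fieldType) (xi : L) : Prop :=
  exists2 n : nat, (0 < n)%N & n.-unity_root xi.

Definition twisted_rational_zero (K : fieldType) (L : closedFieldType)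
    (iota : {rmorphism K -> L}) (U : linear_recurrence K) (a : rat) : Prop :=
  exists (s : nat) (lam : 'I_s -> L) (f : 'I_s -> {poly L}),
    binet_expansion iota U lam f /\
    exists d xi : 'I_s -> L,
      [/\ forall i, determination (lam i) a (d i),
          forall i, is_root_of_unity (xi i) &
          \sum_(i < s) xi i * (f i).[ratr a] * d i = 0].

(* Main.v *)
(* Extend the local ring of K at P to a valuation subring A of Kbar: a maximal
   subring containing it but not 1/p. Write a = k/l, pick mu_i^l = lambda_i, and
   let N = l n_j - k, so that lambda_i^(n_j) = mu_i^k mu_i^N. The mu_i are units
   of A with torsion residues, so each is congruent to a root of unity w_i modulo
   the maximal ideal; as N is divisible by a high power of p, mu_i^N is then
   p-adically close to w_i^N, which takes finitely many values. Hence some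
   sum_i w_i^c f_i(a) mu_i^k is divisible in A by every power of p, and an
   algebraic number with this property is 0. *)

From HB Require Import structures.
Require Import Defs.
From mathcomp Require Import all_boot all_order all_algebra all_field.
From mathcomp Require Import boolp classical_sets constructive_ereal.

From mathcomp Require Import zify ring.

Set Implicit Arguments.
Unset Strict Implicit.
Unset Printing Implicit Defensive.

Import Order.TTheory GRing.Theory Num.Theory.
Local Open Scope ring_scope.

(** * Integer polynomials modulo a prime *)

(** On [Kbar] closeness means that a difference divided by [p%:R ^+ M] lies in [A]. In a general
    valuation ring this is too weak: a nonunit may have no power divisible by p, and a nonzero
    element may be divisible by all powers of p. Algebraicity excludes both. Every algebraic x is a
    root of an integer polynomial with nonzero reduction modulo p; polynomials over 'F_p modulo that
    reduction are finite in number, so two powers of x agree up to p times a polynomial in x. This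
    one relation gives the torsion of residues, the powers of nonunits divisible by p and, over [K],
    the maximality of P together with a uniform exponent e such that p divides u^e for all u in P.
    That exponent plays the part of the ramification index when the valuation, defined through
    powers of P, is converted into divisibility by powers of p. A separate obstacle is that the
    expansion must have nonzero f_i, while minimality of the recurrence is given over [K] only and
    has to be carried over to [Kbar]. *)

Lemma intr_Fp_eq0 (p : nat) (n : int) :
  prime p -> (n%:~R == 0 :> 'F_p) = (p %| n)%Z.
Proof. by move=> p_pr; rewrite -(dvdz_pcharf (pchar_Fp p_pr)). Qed.

Lemma intr_poly_Fp_eq0 (p : nat) (G : {poly int}) : prime p ->
  map_poly (intr : int -> 'F_p) G = 0 -> exists H, G = p%:Z *: H.
Proof.
move=> p_pr G0.
have /polyOverP pG : G \is a polyOver (dvdz p).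
  apply/polyOverP => i.
  suff: (p %| G`_i)%Z by [].
  by rewrite -intr_Fp_eq0// -coef_map G0 coef0.
exists (\poly_(i < size G) (G`_i %/ p)%Z).
apply/polyP => i; rewrite coefZ coef_poly; case: ltnP => [_|szG].
  by rewrite mulrC divzK//; exact: pG.
by rewrite mulr0 nth_default.
Qed.

(** The primitive part of a rational annihilator has content 1, so p cannot divide all its
    coefficients. Its size is recorded because it bounds exponents later. *)
Lemma primitive_annihilator (p : nat) (F : fieldType)
    (phi : {rmorphism rat -> F}) (q : {poly rat}) (x : F) :
  prime p -> q != 0 -> root (map_poly phi q) x ->
  exists G : {poly int}, [/\ size G = size q,
    map_poly (intr : int -> 'F_p) G != 0 & root (map_poly intr G) x].
Proof.
move=> p_pr q0 qx; have [r [a a0 qE]] := rat_poly_scale q.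
have r0 : r != 0.
  by apply: contraNneq q0 => r0; rewrite qE r0 map_poly0 scaler0.
have a0Q : (a%:~R^-1 : rat) != 0 by rewrite invr_eq0 intr_eq0.
exists (zprimitive r); split.
- by rewrite size_zprimitive qE size_scale// size_map_inj_poly//; exact: intr_inj.
- apply/eqP => /(intr_poly_Fp_eq0 p_pr)[H rE].
  have : (p %| zcontents (zprimitive r))%Z by rewrite rE zcontentsZ dvdz_mulr.
  by rewrite zcontents_primitive r0 dvdz1 absz_nat; case: p p_pr {H rE} => [|[|]].
have phiZ (n : int) : phi n%:~R = n%:~R by rewrite rmorph_int.
have mapE (s : {poly int}) : map_poly phi (map_poly intr s) = map_poly intr s.
  by rewrite -map_poly_comp; apply: eq_map_poly => n /=.
have c0 : (zcontents r)%:~R != 0 :> F.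
  by rewrite -phiZ fmorph_eq0 intr_eq0 zcontents_eq0.
move: qx; rewrite qE map_polyZ mapE rootZ ?fmorph_eq0//.
by rewrite [X in map_poly _ X]zpolyEprim map_polyZ rootZ.
Qed.

(* Pigeonhole on the residues of 'X^N modulo G over the prime field. *)
Lemma torsion_modulo_prime (p : nat) (F : fieldType) (G : {poly int}) (x : F) :
  prime p -> map_poly (intr : int -> 'F_p) G != 0 ->
  root (map_poly intr G) x ->
  exists N M (q : {poly int}), [/\ (N <= p ^ size G)%N, (0 < M)%N &
    x ^+ N * (x ^+ M - 1) = p%:R * (map_poly intr q).[x]].
Proof.
move=> p_pr; set g := map_poly _ G => g0 Gx.
have szg : (size g <= size G)%N by exact: size_poly.
(* There is one more exponent than there are vectors holding residues modulo g. The smaller of two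
   colliding exponents is thus at most p^(size g), the bound behind [prime_expr_dvd]. *)
pose h (i : 'I_(#|'rV['F_p]_(size g)|.+1)) : 'rV['F_p]_(size g) :=
  poly_rV ('X^i %% g).
have /injectivePn[i [j ij hij]] : ~~ injectiveb h.
  apply/negP => /injectiveP/leq_card; rewrite card_ord.
  by rewrite ltnn.
wlog lt_ij : i j ij hij / (i < j)%N => [hwlog|].
  have : (i != j :> nat) by [].
  rewrite neq_ltn => /orP[lt|lt]; first exact: (hwlog i j).
  by apply: (hwlog j i) => //; rewrite eq_sym.
have gdvd : g %| 'X^i * ('X^(j - i) - 1).
  rewrite mulrBr mulr1 -exprD subnKC 1?ltnW// /dvdp modpD modpN.
  have szm k : (size ('X^k %% g)%R <= size g)%N by rewrite ltnW// ltn_modp.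
  by rewrite -(poly_rV_K (szm j)) -(poly_rV_K (szm i)) -/(h j) -/(h i) hij subrr.
have /dvdpP[k kE] := gdvd.
pose k0 : {poly int} := map_poly (fun c : 'F_p => (c : nat)%:Z) k.
have k0E : map_poly (intr : int -> 'F_p) k0 = k.
  apply/polyP => l; rewrite coef_map /= coef_map_id0//= -pmulrn natr_Zp//.
have [H HE] : exists H : {poly int},
    'X^i * ('X^(j - i) - 1) - k0 * G = p%:Z *: H.
  apply: (intr_poly_Fp_eq0 p_pr).
  by rewrite rmorphB !rmorphM /= rmorphB /= !map_polyXn rmorph1 k0E kE subrr.
exists i, (j - i)%N, H; split; last 1 first.
- have := congr1 (fun r => (map_poly (intr : int -> F) r).[x]) HE.
  rewrite rmorphB !rmorphM /= rmorphB /= !map_polyXn rmorph1 map_polyZ /=.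
  rewrite !(hornerE, hornerXn) (rootP Gx) mulr0 subr0 => ->.
  by rewrite -pmulrn.
- have iE := ltn_ord i; rewrite ltnS in iE; apply: leq_trans iE _.
  by rewrite card_mx card_Fp// mul1n leq_exp2l// prime_gt1.
- by rewrite subn_gt0.
Qed.

Lemma minPoly_rat (K : fieldExtType rat) (x : K) : exists q : {poly rat},
  [/\ q != 0, (size q <= (\dim {:K}).+1)%N & root (map_poly (in_alg K) q) x].
Proof.
have [/polyOver1P[q qE]] := minPolyOver 1 x.
have szq : size q = size (minPoly 1 x) by rewrite qE size_map_poly.
exists q; rewrite -qE root_minPoly szq size_minPoly ltnS; split=> //.
  by rewrite -size_poly_eq0 szq size_minPoly.
by rewrite adjoin_degreeE dimv1 divn1 dimvS ?subvf.
Qed.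

(** * Valuation subrings *)

(** For a valuation subring this is the maximal ideal: membership in [A] follows, as x or 1/x lies
    in [A]. Zero is listed apart because 0^-1 = 0 belongs to [A]. *)
Definition nonunit (F : fieldType) (A : {pred F}) (x : F) :=
  (x == 0) || (x^-1 \notin A).

Definition valuation_subring (F : fieldType) (A : {pred F}) :=
  forall x : F, x \in A \/ x^-1 \in A.

Lemma Bezout_prime (R : nzRingType) (p : nat) (c : int) :
  prime p -> ~~ (p %| c)%Z ->
  exists u v : int, 1 = u%:~R * c%:~R + v%:~R * p%:R :> R.
Proof.
move=> p_pr pNc; have /coprimezP[[u v] /= uv1] : coprimez c p%:Z.
  by rewrite coprimezE coprime_sym prime_coprime.
by exists u, v; rewrite pmulrn -!intrM -intrD uv1.
Qed.

Lemma subring_divp_Bezout (F : fieldType) (A : subringClosed F) (p : nat)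
    (c : int) (y : F) :
  prime p -> ~~ (p %| c)%Z -> y \in A -> y / p%:R * c%:~R \in A ->
  y / p%:R \in A.
Proof.
move=> p_pr pNc yA; have [p0|p0] := eqVneq (p%:R : F) 0.
  by rewrite p0 invr0 mulr0 rpred0.
have [u [v uv1]] := Bezout_prime F p_pr pNc.
move=> cA; have -> : y / p%:R = y / p%:R * c%:~R * u%:~R + y * v%:~R.
  rewrite [LHS](_ : _ = y / p%:R * (u%:~R * c%:~R + v%:~R * p%:R)).
    by field.
  by rewrite -uv1 mulr1.
by apply: rpredD; apply: rpredM => //; exact: rpred_int.
Qed.

Section Divisibility.
Variables (F : fieldType) (A : subringClosed F).

(** As y is nonzero, factors 'X can be stripped from G; the equation then exhibits the nonzero
    constant term as a multiple of y. *)
Lemma int_poly_nonzero_constant (G : {poly int}) (y : F) : y != 0 -> G != 0 ->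
  root (map_poly intr G) y ->
  exists2 c : int, c != 0 & exists H : {poly int},
    c%:~R = y * (map_poly intr H).[y].
Proof.
move=> y0; elim/poly_ind: G => [|G c IH]; first by rewrite eqxx.
rewrite rmorphD rmorphM /= map_polyX map_polyC /= rootE !hornerE.
have [->|c0 _ /eqP GE] := eqVneq c 0; last first.
  exists c => //; exists (- G); rewrite rmorphN hornerN mulrN mulrC.
  by apply/eqP; rewrite -addr_eq0 addrC GE.
rewrite mulr0z polyC0 !addr0 [X in _ -> is_true X -> _]mulf_eq0 (negPf y0) orbF.
move=> GX0 Gy; apply: IH => //.
by apply: contraNneq GX0 => ->; rewrite mul0r.
Qed.

Lemma int_poly_mem (H : {poly int}) (y : F) :
  y \in A -> (map_poly intr H).[y] \in A.
Proof.
by move=> yA; rewrite rpred_horner//; apply/polyOverP => i; rewrite coef_map rpred_int.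
Qed.

(** By the convention 0^-1 = 0, the hypothesis that 1/p is not in [A] also says that p is nonzero in
    the field. *)
Lemma inv_notin_neq0 (x : F) : x^-1 \notin A -> x != 0.
Proof. by apply: contraNneq => ->; rewrite invr0 rpred0. Qed.

(** If y were nonzero, a nonzero integer c would be a multiple of y, hence divisible in [A] by all
    powers of p. For c = p^k m up to sign, with m prime to p, the exponent k + 1 puts m/p, and by
    Bezout 1/p, in [A]. *)
Lemma padic_separated (p : nat) (G : {poly int}) (y : F) :
  prime p -> (p%:R)^-1 \notin A -> G != 0 -> root (map_poly intr G) y ->
  (forall n, y / p%:R ^+ n \in A) -> y = 0.
Proof.
move=> p_pr pA G0 Gy yA; apply/eqP; apply: contraNT (pA) => y0.
have p0 := inv_notin_neq0 pA.
have [c c0 [H cE]] := int_poly_nonzero_constant y0 G0 Gy.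
have {}yA n : c%:~R / p%:R ^+ n \in A.
  have := yA 0%N; rewrite expr0 divr1 => y0A.
  by rewrite cE mulrAC rpredM ?int_poly_mem.
have c_gt0 : (0 < `|c|)%N by rewrite absz_gt0.
have [m pm cm] := pfactor_coprime p_pr c_gt0.
rewrite -[X in X \in _]mul1r (@subring_divp_Bezout _ _ _ ((-1) ^+ (c < 0)%R * m%:Z))
  ?rpred1//.
  by rewrite dvdzE abszMsign /= -prime_coprime.
have := yA (logn p `|c|).+1; congr (_ \in A).
rewrite {1}(intEsign c) {1}cm exprS PoszM mulrA intrM -mulrA mul1r mulrC; congr (_ * _).
by rewrite -pmulrn natrX invfM mulrCA divff ?mulr1// expf_neq0.
Qed.

End Divisibility.

Section ValuationSubring.
Variables (F : fieldType) (A : subringClosed F).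
Hypothesis valA : valuation_subring A.

Lemma valuation_subring_root (x : F) n : (0 < n)%N -> x ^+ n \in A -> x \in A.
Proof.
move=> n0 xnA; have [//|xA] := valA x.
have [->|x0] := eqVneq x 0; first exact: rpred0.
have -> : x = x ^+ n * x^-1 ^+ n.-1.
  by rewrite -{1}(prednK n0) exprS exprVn mulrK// unitfE expf_neq0.
by rewrite rpredM// rpredX.
Qed.

Lemma valuation_subring_integral (q : {poly F}) (x : F) :
  q \is monic -> q \is a polyOver A -> root q x -> x \in A.
Proof.
move=> q1 qA qx; have [//|xA] := valA x.
have [->|x0] := eqVneq x 0; first exact: rpred0.
have szq : (1 < size q)%N.
  rewrite ltnNge; apply/negP => /size1_polyC qE; move: qx q1.
  rewrite qE rootC => /eqP ->; rewrite monicE lead_coefC eq_sym; exact/negP/oner_neq0.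
move: qx; rewrite /root horner_coef -(prednK (ltnW szq)) big_ord_recr /=.
rewrite -/(lead_coef q) (eqP q1) mul1r addrC addr_eq0 => /eqP xE.
have -> : x = - (\sum_(i < (size q).-1) q`_i * x ^+ i) * x^-1 ^+ (size q).-2.
  rewrite -xE -(prednK (_ : 0 < (size q).-1)%N) /=; last by rewrite -ltnS prednK// ltnW.
  by rewrite exprS exprVn mulrK// unitfE expf_neq0.
rewrite mulNr rpredN mulr_suml rpred_sum// => i _.
rewrite -mulrA rpredM//; first exact: (polyOverP qA).
have le_i : (i <= (size q).-2)%N.
  by case: i => i /=; case: (size q).-1.
rewrite -(subnK le_i) exprD mulrCA -exprMn mulfV// expr1n mulr1.
exact: rpredX.
Qed.

(** One of x/y and y/x lies in [A]. If x/y does, then 1/(x + y) in [A] would put 1/y = (1 + x/y)/(x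
    + y) in [A]. *)
Lemma nonunitD (x y : F) : nonunit A x -> nonunit A y -> nonunit A (x + y).
Proof.
rewrite /nonunit; have [->|x0 /= xA] := eqVneq x 0; first by rewrite add0r.
have [->|y0 /= yA] := eqVneq y 0; first by rewrite addr0 xA orbT.
case: eqVneq => //= xy0.
wlog xyA : x y x0 y0 xA yA xy0 / x / y \in A => [hwlog|].
  have [|] := valA (x / y); first exact: hwlog.
  by rewrite invf_div addrC; apply: hwlog => //; rewrite addrC.
apply: contra yA => xyVA.
have -> : y^-1 = (1 + x / y) * (x + y)^-1.
  by rewrite -(divff y0) -mulrDl [y + x]addrC mulrAC divff ?mul1r.
by rewrite rpredM// rpredD ?rpred1.
Qed.

Lemma nonunitM (x y : F) : x \in A -> nonunit A y -> nonunit A (x * y).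
Proof.
rewrite /nonunit mulf_eq0; have [//|x0 xA] := eqVneq x 0.
have [//|y0 /=] := eqVneq y 0; apply: contra => xyA.
have -> : y^-1 = x * (x * y)^-1 by rewrite invfM mulVKf.
by rewrite rpredM.
Qed.

Lemma nonunit1 : nonunit A 1 = false.
Proof. by rewrite /nonunit oner_eq0 invr1 rpred1. Qed.

Lemma nonunit_mem (x : F) : nonunit A x -> x \in A.
Proof.
by case/orP => [/eqP ->|xA]; [exact: rpred0 | have [|/(negP xA)] := valA x].
Qed.

Lemma nonunitN (x : F) : nonunit A (- x) = nonunit A x.
Proof. by rewrite /nonunit oppr_eq0 invrN rpredN. Qed.

Lemma nonunitX (x : F) n : (0 < n)%N -> nonunit A x -> nonunit A (x ^+ n).
Proof.
case: n => // n _ xA; rewrite exprS mulrC nonunitM// rpredX//; exact: nonunit_mem.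
Qed.

Lemma inv_sub1_mem (x : F) : nonunit A x -> (x - 1)^-1 \in A.
Proof.
move=> xA; apply: contraFT nonunit1 => x1.
rewrite -[1](subKr x) nonunitD// nonunitN /nonunit x1 orbT//.
Qed.

(** Since x^M is in the maximal ideal, x^M - 1 is a unit and can be cancelled. A torsion relation
    thus shows that a power of a nonunit is divisible by p. *)
Lemma nonunit_p_dvd (p N M : nat) (x y : F) : (0 < M)%N -> nonunit A x ->
  y \in A -> x ^+ N * (x ^+ M - 1) = p%:R * y -> x ^+ N / p%:R \in A.
Proof.
move=> M0 xA yA xE; have xM := inv_sub1_mem (nonunitX M0 xA).
have [p0|p0] := eqVneq (p%:R : F) 0; first by rewrite p0 invr0 mulr0 rpred0.
have x10 : x ^+ M - 1 != 0.
  by apply: contraFneq nonunit1 => /eqP; rewrite subr_eq0 => /eqP <-; rewrite nonunitX.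
have -> : x ^+ N / p%:R = y * (x ^+ M - 1)^-1; last by rewrite rpredM.
by apply: (mulIf x10); apply: (mulIf p0); rewrite mulrAC divfK// xE mulrC divfK.
Qed.

End ValuationSubring.

(** * Existence of valuation subrings *)

Local Open Scope classical_set_scope.

Lemma subring_of_closed (F : fieldType) (S : set F) :
  subring_closed (fun x => `[< S x >]) ->
  exists A : subringClosed F, forall x, (x \in A) <-> S x.
Proof.
move=> Sr; pose S' : {pred F} := fun x => `[< S x >].
pose A := HB.pack_for (subringClosed F) S' (GRing.isSubringClosed.Build F S' Sr).
by exists A => x; split=> [/asboolP|/asboolP].
Qed.

Lemma maximal_subring_avoiding (F : fieldType) (B : subringClosed F) (t : F) :
  t \notin B ->
  exists A : subringClosed F, [/\ {subset B <= A}, t \notin A &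
    forall C : subringClosed F, {subset A <= C} -> t \notin C ->
      {subset C <= A}].
Proof.
move=> tB.
(* Adding [B] to every candidate set takes care of the empty chain, whose union is empty: its bound
   is then [B] itself. *)
pose U (S : set F) : set F := fun x => x \in B \/ S x.
pose Q (S : set F) := subring_closed (fun x => `[< U S x >]) /\ ~ U S t.
have [|S [[Sr St] Smax]] := @Zorn_bigcup F Q.
  move=> X XQ Xtot.
  have Ucup x : U (\bigcup_(Y in X) Y) x -> x \in B \/ exists2 Y, X Y & U Y x.
    by move=> [|[Y XY Yx]]; [left | right; exists Y => //; right].
  have cupU Y x : X Y -> U Y x -> U (\bigcup_(Y in X) Y) x.
    by move=> XY [|Yx]; [left | right; exists Y].
  have pair x y : U (\bigcup_(Y in X) Y) x -> U (\bigcup_(Y in X) Y) y ->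
      (x \in B /\ y \in B) \/ exists2 Y, X Y & U Y x /\ U Y y.
    move=> /Ucup[xB|[Y XY Yx]] /Ucup[yB|[Z XZ Zy]].
    - by left.
    - by right; exists Z => //; split=> //; left.
    - by right; exists Y => //; split=> //; left.
    - right; case: (Xtot _ _ XY XZ) => sub.
        by exists Z => //; split=> //; case: Yx => [|/sub]; [left|right].
      by exists Y => //; split=> //; case: Zy => [|/sub]; [left|right].
  split; last first.
    by move=> /Ucup[tB'|[Y /XQ[_ + Yt]]]; [exact: (negP tB) | exact].
  split.
  - by apply/asboolP; left; exact: rpred1.
  - move=> x y /asboolP Ux /asboolP Uy; apply/asboolP.
    have [[xB yB]|[Y XY [Yx Yy]]] := pair _ _ Ux Uy; first by left; rewrite rpredB.
    have [[_ subY _] _] := XQ _ XY.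
    by apply: (cupU Y) => //; apply/asboolP/subY; exact/asboolP.
  - move=> x y /asboolP Ux /asboolP Uy; apply/asboolP.
    have [[xB yB]|[Y XY [Yx Yy]]] := pair _ _ Ux Uy; first by left; rewrite rpredM.
    have [[_ _ mulY] _] := XQ _ XY.
    by apply: (cupU Y) => //; apply/asboolP/mulY; exact/asboolP.
have [A AE] := subring_of_closed Sr.
exists A; split=> [x xB||C AC tC x xC].
- by apply/AE; left.
- by apply/negP => /AE.
- have [[xB|Sx]|nUx] := pselect (U S x); [by apply/AE; left|by apply/AE; right|].
  pose C' : set F := fun x => x \in C.
  exfalso; apply: (Smax C').
    split=> [y Sy|]; first by rewrite /C' AC//; apply/AE; right.
    by move=> /(_ x xC) Sx; apply: nUx; right.
  have UC y : U C' y <-> y \in C.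
    by split=> [[yB|//]|]; [apply: AC; apply/AE; left | right].
  split; last by move=> /UC; exact/negP.
  split; first by apply/asboolP/UC; exact: rpred1.
    by move=> y z /asboolP/UC yC /asboolP/UC zC; apply/asboolP/UC; rewrite rpredB.
  by move=> y z /asboolP/UC yC /asboolP/UC zC; apply/asboolP/UC; rewrite rpredM.
Qed.

Lemma adjoin_subring (F : fieldType) (A : subringClosed F) (x : F) :
  exists C : subringClosed F, forall y, (y \in C) <->
    exists2 q : {poly F}, q \is a polyOver A & y = q.[x].
Proof.
apply: (@subring_of_closed F (fun y => exists2 q, q \is a polyOver A & y = q.[x])).
split.
- by apply/asboolP; exists 1; rewrite ?rpred1 ?hornerC.
- move=> _ _ /asboolP[q qA ->] /asboolP[r rA ->]; apply/asboolP.
  by exists (q - r); rewrite ?rpredB ?hornerD ?hornerN.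
- move=> _ _ /asboolP[q qA ->] /asboolP[r rA ->]; apply/asboolP.
  by exists (q * r); rewrite ?rpredM ?hornerM.
Qed.

Lemma polyOver_take (F : fieldType) (A : subringClosed F) n (q : {poly F}) :
  q \is a polyOver A -> take_poly n q \is a polyOver A.
Proof.
move=> /polyOverP qA; apply/polyOverP => i; rewrite coef_take_poly.
by case: ifP; rewrite ?rpred0.
Qed.

Lemma horner_rev (F : fieldType) (r : {poly F}) (x : F) n : x != 0 ->
  (size r <= n.+1)%N -> x ^+ n * r.[x^-1] = \sum_(i < n.+1) r`_i * x ^+ (n - i).
Proof.
move=> x0 szr; rewrite (horner_coef_wide _ szr) mulr_sumr; apply: eq_bigr => i _.
rewrite mulrCA; congr (_ * _); have le_i : (i <= n)%N by rewrite -ltnS.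
by rewrite -{1}(subnK le_i) exprD -mulrA exprVn mulfV ?mulr1// expf_neq0.
Qed.

(** * Chevalley's theorem: a subring maximal among those avoiding 1/t is a valuation ring *)

Section Chevalley.
Variables (F : fieldType) (A : subringClosed F) (t : F).
Hypotheses (tA : t \in A) (tVA : t^-1 \notin A).
Hypothesis Amax : forall C : subringClosed F,
  {subset A <= C} -> t^-1 \notin C -> {subset C <= A}.

Let t0 : t != 0 := inv_notin_neq0 tVA.

Lemma maximal_subring_adjoin (x : F) : x \notin A ->
  exists2 q : {poly F}, q \is a polyOver A & t * q.[x] = 1.
Proof.
move=> xA; have [C CE] := adjoin_subring A x.
have AC : {subset A <= C}.
  by move=> y yA; apply/CE; exists y%:P; rewrite ?polyOverC ?hornerC.
have xC : x \in C by apply/CE; exists 'X; rewrite ?polyOverX ?hornerX.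
have [/CE[q qA qE]|tC] := boolP (t^-1 \in C).
  by exists q => //; rewrite -qE mulfV.
by move: xA; rewrite (Amax AC tC xC).
Qed.

(** Otherwise maximality gives 1/t = q(1/u) with q over [A]. Since u^n = 1 - t b' with b' in [A],
    multiplying by u^n for n = [size q] yields 1/t = u^n q(1/u) + b', an element of [A]. *)
Lemma maximal_subring_inv1B (b : F) : b \in A -> (1 - t * b)^-1 \in A.
Proof.
move=> bA; set u := 1 - t * b.
have uA : u \in A by rewrite rpredB ?rpred1 ?rpredM.
have u0 : u != 0.
  apply: contraNneq tVA => /eqP; rewrite subr_eq0 => /eqP tb1.
  by rewrite -[t^-1]mulr1 tb1 mulKf.
apply: contraNT tVA => /maximal_subring_adjoin[q qA qE].
pose n := size q.
have [b' b'A unE] : exists2 b', b' \in A & u ^+ n = 1 - t * b'.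
  elim: n => [|k [b' b'A unE]]; first by exists 0; rewrite ?rpred0 ?mulr0 ?subr0.
  exists (b + b' - t * b * b'); first by rewrite !(rpredB, rpredD, rpredM).
  by rewrite exprS unE /u; ring.
have -> : t^-1 = u ^+ n * q.[u^-1] + b'.
  apply: (mulfI t0); rewrite mulfV// mulrDr mulrCA qE mulr1 unE; ring.
rewrite rpredD// (@horner_rev _ q u n)// rpred_sum// => i _.
by rewrite rpredM ?rpredX// (polyOverP qA).
Qed.

(* Multiplying t r(1/x) = 1 by x^(deg q) expresses the leading monomial of q
   through lower ones, since 1 - t r(0) is invertible in A. *)
Lemma maximal_subring_not_both (x : F) (q r : {poly F}) :
  q \is a polyOver A -> r \is a polyOver A ->
  t * q.[x] = 1 -> t * r.[x^-1] = 1 -> False.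
Proof.
have [m] := ubnP (size q + size r).
elim: m x q r => // m IH x q r; rewrite ltnS => szqr.
wlog szrq : x q r szqr / (size r <= size q)%N => [hwlog|].
  have [|/ltnW] := leqP (size r) (size q); first exact: hwlog.
  move=> szqr' qA rA qx rx.
  by apply: (hwlog x^-1 r q); rewrite ?invrK// addnC.
move=> qA rA qx rx; have [x0|x0] := eqVneq x 0.
  move: qx; rewrite x0 horner_coef0 => tq; move/negP: tVA; apply.
  by rewrite -[t^-1]mulr1 -tq mulKf//; exact: (polyOverP qA).
case sq: (size q) szrq => [|n] szrq.
  move/eqP: sq; rewrite size_poly_eq0 => /eqP q0.
  by move/eqP: qx; rewrite q0 horner0 mulr0 eq_sym oner_eq0.
have rxn : (1 - t * r`_0) * x ^+ n = t * \sum_(i < n) r`_i.+1 * x ^+ (n - i.+1).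
  have := horner_rev x0 szrq; rewrite big_ord_recl /= subn0 => E.
  rewrite mulrBl mul1r -mulrA; apply/eqP; rewrite subr_eq addrC -mulrDr -E.
  by rewrite mulrCA rx mulr1.
pose c := (1 - t * r`_0)^-1.
have cA : c \in A by rewrite maximal_subring_inv1B// (polyOverP rA).
have c0 : 1 - t * r`_0 != 0.
  apply: contraNneq tVA => /eqP; rewrite subr_eq0 => /eqP tb1.
  by rewrite -[t^-1]mulr1 tb1 mulKf// (polyOverP rA).
pose s := take_poly n q + \poly_(j < n) (q`_n * (t * (c * r`_(n - j)))).
apply: (IH x s r) => //.
- apply: leq_trans szqr; rewrite sq addSn ltnS leq_add2r.
  rewrite (leq_trans (size_polyD _ _))// geq_max size_poly andbT.
  exact: size_take_poly.
- rewrite rpredD ?polyOver_take// ; apply/polyOver_poly => j _.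
  by rewrite !rpredM// ?(polyOverP qA) ?(polyOverP rA).
rewrite -qx; congr (_ * _); rewrite hornerD horner_poly.
rewrite (horner_coef_wide x (size_take_poly n q)) horner_coef sq big_ord_recr /=.
congr (_ + _).
  by apply: eq_bigr => i _; rewrite coef_take_poly ltn_ord.
have -> : x ^+ n = t * \sum_(i < n) c * r`_i.+1 * x ^+ (n - i.+1).
  apply: (mulfI c0); rewrite rxn mulrCA; congr (_ * _).
  by rewrite mulr_sumr; apply: eq_bigr => i _; rewrite -!mulrA mulVKf.
rewrite mulrA mulr_sumr (reindex_inj rev_ord_inj) /=; apply: eq_bigr => i _.
by rewrite subKn// !mulrA.
Qed.

Lemma maximal_subring_valuation : valuation_subring A.
Proof.
move=> x; have [|xA] := boolP (x \in A); first by left.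
right; apply: contraT => xVA.
have [q qA qx] := maximal_subring_adjoin xA.
have [r rA rx] := maximal_subring_adjoin xVA.
by case: (maximal_subring_not_both qA rA qx rx).
Qed.

End Chevalley.

Lemma valuation_subring_above (F : fieldType) (B : subringClosed F) (t : F) :
  t \in B -> t^-1 \notin B ->
  exists A : subringClosed F,
    [/\ {subset B <= A}, t^-1 \notin A & valuation_subring A].
Proof.
move=> tB tVB; have [A [BA tVA Amax]] := maximal_subring_avoiding tVB.
by exists A; split=> //; apply: maximal_subring_valuation Amax => //; exact: BA.
Qed.

(** * Approximation of units by roots of unity *)

Section OneUnits.
Variables (F : fieldType) (A : subringClosed F) (p : nat).
Hypotheses (valA : valuation_subring A) (pVA : (p%:R)^-1 \notin A).

Let p0 : (p%:R : F) != 0 := inv_notin_neq0 pVA.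

Lemma subX1_mem (z d : F) n : z \in A -> (z - 1) / d \in A -> (z ^+ n - 1) / d \in A.
Proof.
move=> zA z1; rewrite subrX1 mulrAC rpredM// rpred_sum// => i _; exact: rpredX.
Qed.

(** Each p-th power gains a factor t: z^p - 1 is z - 1 times the sum of z^i for i < p, and that sum
    is p modulo t. *)
Lemma one_unit_Xp (y t : F) j : y \in A -> t != 0 -> p%:R / t \in A ->
  (y - 1) / t \in A -> (y ^+ (p ^ j) - 1) / t ^+ j.+1 \in A.
Proof.
move=> yA t0 pt yt; elim: j => [|j IH]; first by rewrite expn0 !expr1.
rewrite expnSr exprM; set z := y ^+ (p ^ j) in IH *.
have zA : z \in A by exact: rpredX.
have zt : (z - 1) / t \in A by exact: subX1_mem.
rewrite subrX1 [t ^+ _]exprSr invfM mulrACA rpredM//.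
have -> : \sum_(i < p) z ^+ i = \sum_(i < p) (z ^+ i - 1) + p%:R.
  by rewrite sumrB sumr_const card_ord subrK.
rewrite mulrDl rpredD// mulr_suml rpred_sum// => i _; exact: subX1_mem.
Qed.

Lemma one_unit_limit (x : F) N : nonunit A x -> x ^+ N / p%:R \in A ->
  forall M, exists j, forall m : int,
    ((1 + x) ^ ((p ^ j)%:Z * m) - 1) / p%:R ^+ M \in A.
Proof.
move=> xA xN M; have xA' := nonunit_mem valA xA.
have yA : 1 + x \in A by rewrite rpredD ?rpred1.
have y0 : 1 + x != 0.
  apply: contraTneq xA => /eqP; rewrite addrC addr_eq0 => /eqP ->.
  by rewrite nonunitN nonunit1.
have yVA : (1 + x)^-1 \in A.
  by rewrite -rpredN -invrN opprD addrC inv_sub1_mem// nonunitN.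
(* Of p and x, [t] is the one that divides the other; in both cases t^(N+1) is a multiple of p. With
   j = (N+1)M the next power t^(j+1) is then a multiple of p^M. *)
have [t [t0 pt xt tN]] : exists t : F, [/\ t != 0, p%:R / t \in A, x / t \in A
    & t ^+ N.+1 / p%:R \in A].
  have xp_case : x / p%:R \in A -> exists t : F, [/\ t != 0, p%:R / t \in A,
      x / t \in A & t ^+ N.+1 / p%:R \in A].
    exists p%:R; rewrite divff ?rpred1//; split=> //.
    by rewrite exprSr mulfK// rpredX ?rpred_nat.
  have [x0|x0] := eqVneq x 0; first by apply: xp_case; rewrite x0 mul0r rpred0.
  have [|px] := valA (x / p%:R); first exact: xp_case.
  exists x; rewrite divff ?rpred1//; split=> //; first by rewrite -invf_div.
  by rewrite exprS -mulrA rpredM.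
have tA : t \in A.
  apply: (valuation_subring_root valA (ltn0Sn N)).
  by rewrite -[_ ^+ _](divfK p0) rpredM ?rpred_nat.
exists (N.+1 * M)%N => m; rewrite -exprz_exp.
set z := (1 + x) ^ _.
have zA : z \in A by exact: rpredX.
have zVA : z^-1 \in A by rewrite /z -exprVn rpredX.
have zM : (z - 1) / p%:R ^+ M \in A.
  have := one_unit_Xp (N.+1 * M) yA t0 pt; rewrite addrAC subrr add0r => /(_ xt) zt.
  have -> : (z - 1) / p%:R ^+ M =
      (z - 1) / t ^+ (N.+1 * M).+1 * (t * (t ^+ N.+1 / p%:R) ^+ M).
    by rewrite exprMn exprVn -exprM [t * _]mulrA -exprS mulrA divfK ?expf_neq0.
  by rewrite rpredM// rpredM// rpredX.
case: m => m; first by exact: subX1_mem.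
rewrite NegzE -exprnN.
have -> : z ^- m.+1 - 1 = - (z ^+ m.+1 - 1) * z^-1 ^+ m.+1.
  by rewrite opprB mulrBl mul1r exprVn mulfV// expf_neq0// /z expf_neq0.
by rewrite mulNr mulNr rpredN mulrAC rpredM ?rpredX// subX1_mem.
Qed.

End OneUnits.

Lemma root_of_unity_approx (L : closedFieldType) (A : subringClosed L) (p : nat)
    (mu : L) :
  valuation_subring A -> (p%:R)^-1 \notin A -> prime p ->
  (forall x : L, exists G : {poly int}, map_poly (intr : int -> 'F_p) G != 0 /\
    root (map_poly intr G) x) ->
  mu != 0 -> mu \in A -> mu^-1 \in A ->
  exists (w : L) Q, [/\ (0 < Q)%N, w ^+ Q = 1, w \in A &
    forall M, exists j, forall m : int,
      (mu ^ ((p ^ j)%:Z * m) - w ^ ((p ^ j)%:Z * m)) / p%:R ^+ M \in A].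
Proof.
move=> valA pVA p_pr alg mu0 muA muVA; have p0 := inv_notin_neq0 pVA.
have torsion x : x \in A -> exists N M y, [/\ (0 < M)%N, y \in A &
    x ^+ N * (x ^+ M - 1) = p%:R * y].
  move=> xA; have [G [G0 Gx]] := alg x.
  have [N [M [q [_ M0 E]]]] := torsion_modulo_prime p_pr G0 Gx.
  by exists N, M, (map_poly intr q).[x]; split=> //; exact: int_poly_mem.
have [N [Q [y [Q0 yA muQ]]]] := torsion _ muA.
have [r rE] := closed_field_poly_normal ('X^Q - 1 : {poly L}).
move: rE; rewrite (monicP (monicXnsubC 1 Q0)) scale1r => rE.
(* mu^Q - 1 is the product of mu - z over the Q-th roots of unity z, and nonunits form a prime
   ideal, so some mu - z is a nonunit. *)
have muQ_nonunit : nonunit A (mu ^+ Q - 1).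
  have -> : mu ^+ Q - 1 = (mu^-1 ^+ N * y) * p%:R.
    by rewrite -mulrA [y * _]mulrC -muQ mulrA -exprMn mulVf// expr1n mul1r.
  by rewrite nonunitM ?rpredM ?rpredX// /nonunit pVA orbT.
have [w wr wmu] : exists2 w, w \in r & nonunit A (mu - w).
  have : nonunit A (\prod_(z <- r) (mu - z)).
    have := congr1 (horner^~ mu) rE; rewrite /= hornerD hornerN hornerXn hornerC horner_prod.
    by under eq_bigr do rewrite hornerXsubC; move=> <-.
  elim: (r) => [|z s IH]; first by rewrite big_nil nonunit1.
  rewrite big_cons; have [zmu _|zmu] := boolP (nonunit A (mu - z)).
    by exists z; rewrite ?mem_head.
  move=> prodA; case: IH => [|w ws wmu]; last by exists w; rewrite // inE ws orbT.
  have /andP[z0 zA] : (mu - z != 0) && ((mu - z)^-1 \in A).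
    by move: zmu; rewrite /nonunit negb_or negbK.
  by rewrite -[X in nonunit A X](mulKf z0) nonunitM.
have wQ : w ^+ Q = 1.
  have : root ('X^Q - 1) w by rewrite rE root_prod_XsubC.
  by rewrite rootE hornerD hornerN hornerXn hornerC subr_eq0 => /eqP.
have wA : w \in A by apply: (valuation_subring_root valA Q0); rewrite wQ rpred1.
have w0 : w != 0.
  by apply/eqP => w0; move/eqP: wQ; rewrite w0 expr0n eqn0Ngt Q0 eq_sym oner_eq0.
have wVA : w^-1 \in A.
  by apply: (valuation_subring_root valA Q0); rewrite exprVn wQ invr1 rpred1.
exists w, Q; split=> // M.
(* Here mu/w = 1 + x for a nonunit x, and the torsion relation of x itself provides the power of x
   divisible by p. *)
have xA : nonunit A ((mu - w) * w^-1) by rewrite mulrC nonunitM.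
have [N' [M' [y' [M'0 y'A xE]]]] := torsion _ (nonunit_mem valA xA).
have xN := nonunit_p_dvd valA M'0 xA y'A xE.
have [j jP] := one_unit_limit valA pVA xA xN M.
exists j => m; have := jP m; set n : int := _ * m.
have -> : 1 + (mu - w) / w = mu / w by rewrite mulrBl divff// addrC subrK.
rewrite exprzMl ?unitfE ?invr_eq0// => nP.
have wn0 : w ^ n != 0 by rewrite expfz_neq0.
have -> : mu ^ n - w ^ n = w ^ n * (mu ^ n * w^-1 ^ n - 1).
  by rewrite mulrBr mulr1 exprz_inv mulrCA -expfzDr// subrr expr0z mulr1.
rewrite -mulrA rpredM//.
by case: (n) => k; [exact: rpredX | rewrite NegzE -exprnN -exprVn rpredX].
Qed.

(** * Powers of a prime ideal and the prime valuation *)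

Section IdealPower.
Variables (R : comNzRingType) (I : prime_idealr R).

Lemma ideal_power0 x : ideal_power I 0 x.
Proof.
exists 1%N, (fun=> x), (fun=> fun=> 0); split; first by move=> i [].
by rewrite big_ord1 big_ord0 mulr1.
Qed.

Lemma ideal_powerD n x y :
  ideal_power I n x -> ideal_power I n y -> ideal_power I n (x + y).
Proof.
move=> [m [c [a [aI ->]]]] [m' [c' [a' [a'I ->]]]].
exists (m + m')%N, (fun i => match split i with inl j => c j | inr j => c' j end),
  (fun i => match split i with inl j => a j | inr j => a' j end); split.
  by move=> i j; case: (split i).
rewrite big_split_ord /=; congr (_ + _); apply: eq_bigr => i _.
  by rewrite (unsplitK (inl _ i)).
by rewrite (unsplitK (inr _ i)).
Qed.

Lemma ideal_powerMl n r x : ideal_power I n x -> ideal_power I n (r * x).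
Proof.
move=> [m [c [a [aI ->]]]]; exists m, (fun i => r * c i), a; split=> //.
by rewrite mulr_sumr; apply: eq_bigr => i _; rewrite mulrA.
Qed.

Lemma ideal_powerS n u x : u \in I -> ideal_power I n x ->
  ideal_power I n.+1 (u * x).
Proof.
move=> uI [m [c [a [aI ->]]]].
exists m, c, (fun i j => if unlift ord0 j is Some k then a i k else u); split.
  by move=> i j; case: (unlift ord0 j).
rewrite mulr_sumr; apply: eq_bigr => i _; rewrite big_ord_recl unlift_none.
by rewrite mulrCA; under [in RHS]eq_bigr do rewrite liftK.
Qed.

Lemma ideal_powerX n u : u \in I -> ideal_power I n (u ^+ n).
Proof.
move=> uI; elim: n => [|n IH]; first exact: ideal_power0.
by rewrite exprS; exact: ideal_powerS.
Qed.

Lemma ideal_power_leq m n x : (m <= n)%N -> ideal_power I n x -> ideal_power I m x.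
Proof.
move=> /subnK <-; elim: (n - m)%N => // k IH [l [c [a [aI xE]]]]; apply: IH.
exists l, (fun i => c i * a i ord0), (fun i j => a i (lift ord0 j)); split=> //.
by rewrite xE; apply: eq_bigr => i _; rewrite big_ord_recl mulrA.
Qed.

(** With v = 1 - s t, the geometric sum gives z = t (1 + ... + v^(n-1)) (s z) + z v^n, and both
    terms lie in I^n. *)
Lemma ideal_power_cancel n s t z : 1 - s * t \in I ->
  ideal_power I n (s * z) -> ideal_power I n z.
Proof.
move=> stI szI; set v := 1 - s * t in stI.
have -> : z = (t * \sum_(i < n) v ^+ i) * (s * z) + z * v ^+ n.
  have -> : (t * \sum_(i < n) v ^+ i) * (s * z) = z * ((1 - v) * \sum_(i < n) v ^+ i).
    by rewrite /v; ring.
  by rewrite -opprB mulNr -subrX1 opprB mulrBr mulr1 subrK.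
apply: ideal_powerD; apply: ideal_powerMl => //; exact: ideal_powerX.
Qed.

End IdealPower.

Lemma integralX (R K : comNzRingType) (phi : {rmorphism R -> K}) (x : K) n :
  integralOver phi x -> integralOver phi (x ^+ n).
Proof.
move=> xI; elim: n => [|n IH]; first exact: integral1.
by rewrite exprS; exact: integral_mul.
Qed.

Lemma horner_drop_polyS (K : comNzRingType) (G : {poly int}) (w : K) k :
  (map_poly intr (drop_poly k G)).[w] =
  (G`_k)%:~R + w * (map_poly intr (drop_poly k.+1 G)).[w].
Proof.
have -> : drop_poly k G = (G`_k)%:P + drop_poly k.+1 G * 'X.
  apply/polyP => -[|i]; rewrite coefD coefC coefMX !coef_drop_poly ?addr0//.
  by rewrite add0r addSnnS.
by rewrite rmorphD rmorphM /= map_polyC map_polyX !hornerE mulrC.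
Qed.

(* Classically, if c_n w^n + ... + c_0 = 0 then all c_n w^j + ... + c_(n-j) are
   integral. *)
Lemma integral_drop_poly (K : fieldType) (G : {poly int}) (w : K) k :
  root (map_poly intr G) w ->
  integralOver (intr : int -> K) (map_poly intr (drop_poly k G)).[w].
Proof.
move=> Gw; pose e k := (map_poly (intr : int -> K) (drop_poly k G)).[w].
rewrite -/(e k).
have [m] := ubnP (size G - k); elim: m k => // m IH k szk.
have [szG|ltG] := leqP (size G) k.
  by rewrite /e drop_poly_eq0// rmorph0 horner0; exact: integral0.
have {IH}IH : integralOver intr (e k.+1) by apply: IH; lia.
rewrite /e horner_drop_polyS -/(e _); apply: integral_add; first exact: integral_id.
(* This monic polynomial vanishes at [w * e k.+1]: its value there is [e k.+1 ^+ k] times G(w). Its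
   coefficients are integral because [e k.+1] is, by induction. *)
pose r := 'X^(k.+1) + \poly_(i < k.+1) ((G`_i)%:~R * e k.+1 ^+ (k - i)).
apply: (@integral_root_monic _ _ _ _ r).
- by rewrite monicE lead_coefDl ?lead_coefXn// size_polyXn ltnS size_poly.
- rewrite rootE hornerD hornerXn horner_poly.
  suff -> : (w * e k.+1) ^+ k.+1 + \sum_(i < k.+1)
      (G`_i)%:~R * e k.+1 ^+ (k - i) * (w * e k.+1) ^+ i =
      e k.+1 ^+ k * (map_poly intr G).[w] by rewrite (rootP Gw) mulr0.
  rewrite -[in RHS](poly_take_drop k.+1 G) rmorphD rmorphM /= map_polyXn.
  rewrite hornerD hornerM hornerXn -/(e _) addrC mulrDr; congr (_ + _).
    rewrite (@horner_coef_wide _ k.+1); last first.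
      by rewrite (leq_trans (size_poly _ _))// size_take_poly.
    rewrite mulr_sumr; apply: eq_bigr => i _.
    rewrite coef_map coef_take_poly ltn_ord /= exprMn.
    have le_i : (i <= k)%N by rewrite -ltnS.
    have -> : e k.+1 ^+ k = e k.+1 ^+ (k - i) * e k.+1 ^+ i by rewrite -exprD subnK.
    by ring.
  by rewrite exprMn [e _ ^+ _.+1]exprSr; ring.
- move=> _ /(nthP 0)[i _ <-]; rewrite coefD coefXn coef_poly.
  apply: integral_add; first exact: integral_nat.
  case: ifP => _; last exact: integral0.
  by apply: integral_mul; [exact: integral_id | exact: integralX].
Qed.

(** * The local ring of [K] at [P], and the valuation attached to [P] *)

Section LocalRing.
Variables (K : fieldExtType rat) (P : number_field_prime K) (p : nat).
Hypotheses (p_pr : prime p) (pP : p%:R \in nfp_ideal P).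

Local Notation valR := (val : {rmorphism ring_of_integers K -> K}).

Lemma roi_val_neq0 (s : ring_of_integers K) : s \notin nfp_ideal P -> val s != 0.
Proof.
apply: contraNneq => s0; have -> : s = 0 by apply: val_inj; rewrite s0 rmorph0.
exact: rpred0.
Qed.

Lemma prime_notin1 : 1 \notin nfp_ideal P.
Proof. by rewrite idealr1. Qed.

Lemma roi_of_integral (w : K) : integralOver (intr : int -> K) w ->
  exists u : ring_of_integers K, val u = w.
Proof.
move=> wI; have wI' : w \in @algebraic_integer K by apply/asboolP.
by exists (RingOfIntegers wI').
Qed.

Lemma intr_notin_prime (c : int) : ~~ (p %| c)%Z -> c%:~R \notin nfp_ideal P.
Proof.
move=> pNc; apply: contra prime_notin1 => cP.
have [u [v ->]] := Bezout_prime (ring_of_integers K) p_pr pNc.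
by rewrite rpredD// idealMr.
Qed.

Definition in_localization (w : K) := exists u s : ring_of_integers K,
  s \notin nfp_ideal P /\ w = val u / val s.

Lemma prime_notinM (s t : ring_of_integers K) :
  s \notin nfp_ideal P -> t \notin nfp_ideal P -> s * t \notin nfp_ideal P.
Proof. by move=> sP tP; rewrite prime_idealrM negb_or sP tP. Qed.

Lemma localization_subring :
  exists B : subringClosed K, forall w, (w \in B) <-> in_localization w.
Proof.
apply: subring_of_closed; split.
- apply/asboolP; exists 1, 1; rewrite prime_notin1; split=> //.
  by rewrite rmorph1 divr1.
- move=> _ _ /asboolP[u [s [sP ->]]] /asboolP[v [t [tP ->]]]; apply/asboolP.
  exists (u * t - v * s), (s * t); split; first exact: prime_notinM.
  have s0 := roi_val_neq0 sP; have t0 := roi_val_neq0 tP.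
  by rewrite rmorphB !rmorphM /=; field; rewrite s0 t0.
- move=> _ _ /asboolP[u [s [sP ->]]] /asboolP[v [t [tP ->]]]; apply/asboolP.
  exists (u * v), (s * t); split; first exact: prime_notinM.
  by rewrite !rmorphM /= invfM mulrACA.
Qed.

Lemma number_field_annihilator (w : K) : exists G : {poly int},
  [/\ (size G <= (\dim {:K}).+1)%N, map_poly (intr : int -> 'F_p) G != 0 &
      root (map_poly intr G) w].
Proof.
have [q [q0 szq qw]] := minPoly_rat w.
have [G [szG G0 Gw]] := primitive_annihilator p_pr q0 qw.
by exists G; rewrite szG.
Qed.

(** Take an integer relation for w with coefficients c_k, and let e_k be its tails. The e_k and f_k
    = w e_(k+1) = e_k - c_k are integral. If some e_(k+1) is outside P, then w = f_k/e_(k+1) is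
    local. Otherwise all e_k are in P; for a c_k prime to p, hence outside P, also f_k is outside P,
    and 1/w = e_(k+1)/f_k. *)
Lemma localization_dichotomy (w : K) : in_localization w \/
  exists u s, [/\ u \in nfp_ideal P, s \notin nfp_ideal P & w^-1 = val u / val s].
Proof.
have [G [_ G0 Gw]] := number_field_annihilator w.
have /choice[e eE] : forall k, exists u : ring_of_integers K,
    val u = (map_poly intr (drop_poly k G)).[w].
  by move=> k; exact: roi_of_integral (integral_drop_poly k Gw).
have /choice[f fE] : forall k, exists u : ring_of_integers K,
    val u = w * val (e k.+1).
  move=> k; exists (e k - (G`_k)%:~R).
  by rewrite rmorphB rmorph_int /= !eE horner_drop_polyS addrAC subrr add0r.
have efE k : e k = (G`_k)%:~R + f k.
  by apply: val_inj; rewrite rmorphD rmorph_int /= fE !eE horner_drop_polyS.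
have [[k ekP]|eP] := pselect (exists k, e k.+1 \notin nfp_ideal P).
  left; exists (f k), (e k.+1); split=> //.
  by rewrite fE mulfK// roi_val_neq0.
have {}eP k : e k \in nfp_ideal P.
  case: k => [|k]; last by apply: contraT => ekP; case: eP; exists k.
  have -> : e 0%N = 0 by apply: val_inj; rewrite eE drop_poly0l (rootP Gw) rmorph0.
  exact: rpred0.
right; have [k pNk] : exists k, ~~ (p %| G`_k)%Z.
  apply: contrapT => pG; case/eqP: G0; apply/polyP => k.
  rewrite coef_map coef0 /=; apply/eqP; rewrite intr_Fp_eq0//.
  by apply: contraT => pNk; case: pG; exists k.
have fP : f k \notin nfp_ideal P.
  apply: contra (intr_notin_prime pNk) => fP.
  by have -> : (G`_k)%:~R = e k - f k; [rewrite efE addrK | rewrite rpredB].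
exists (e k.+1), (f k); split=> //.
have := roi_val_neq0 fP; rewrite fE mulf_eq0 negb_or => /andP[w0 e0].
by rewrite invfM mulrCA mulfV ?mulr1.
Qed.

(** This is the maximality of P. Torsion modulo p puts s^N (s^M - 1) in P; as s^N is outside P, the
    inverse modulo P is t = s^(M-1). *)
Lemma prime_sub1_inv (s : ring_of_integers K) : s \notin nfp_ideal P ->
  exists t, 1 - s * t \in nfp_ideal P.
Proof.
move=> sP; have [G [_ G0 Gs]] := number_field_annihilator (val s).
have [N [M [q [_ M0 E]]]] := torsion_modulo_prime p_pr G0 Gs.
have : s ^+ N * (s ^+ M - 1) \in nfp_ideal P.
  have -> : s ^+ N * (s ^+ M - 1) = (map_poly intr q).[s] * p%:R.
    apply: val_inj; rewrite !(rmorphM, rmorphB, rmorphXn, rmorph_nat, rmorph1) /=.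
    rewrite E mulrC; congr (_ * _).
    rewrite -[RHS](horner_map valR).
    rewrite -map_poly_comp; congr (_.[_]); apply: eq_map_poly => c.
    by rewrite -[LHS](rmorph_int valR).
  by rewrite idealMr.
rewrite prime_idealrM => /orP[sN|sM].
  suff : s ^+ N \notin nfp_ideal P by rewrite sN.
  elim: (N) => [|n IH]; first exact: prime_notin1.
  by rewrite exprS prime_notinM.
exists (s ^+ M.-1); rewrite -exprS prednK//.
by rewrite -rpredN opprB.
Qed.

Variable B : subringClosed K.
Hypothesis BE : forall w, (w \in B) <-> in_localization w.

Lemma localization_val (u : ring_of_integers K) : val u \in B.
Proof.
by apply/BE; exists u, 1; rewrite prime_notin1 rmorph1 divr1.
Qed.

Lemma localization_nonunit (u : ring_of_integers K) :
  u \in nfp_ideal P -> nonunit B (val u).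
Proof.
move=> uP; rewrite /nonunit; have [//|u0 /=] := eqVneq (val u) 0.
apply/negP => /BE[a [s [sP E]]]; case/negP: (sP).
have -> : s = a * u.
  apply: val_inj; have s0 := roi_val_neq0 sP.
  apply: (mulIf (_ : (val s)^-1 != 0)); rewrite ?invr_eq0// divff//.
  by rewrite rmorphM /= mulrAC -E mulVf.
by rewrite idealMr.
Qed.

Lemma localization_valuation : valuation_subring B.
Proof.
move=> w; have [/BE wB|[u [s [uP sP ->]]]] := localization_dichotomy w; first by left.
by right; apply/BE; exists u, s.
Qed.

Lemma localization_pV : (p%:R)^-1 \notin B.
Proof.
have := localization_nonunit pP; rewrite /nonunit rmorph_nat.
have -> : (p%:R == 0 :> K) = false; last by [].
rewrite -(rmorph_nat (in_alg K)) fmorph_eq0 pnatr_eq0.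
by case: (p) p_pr.
Qed.

Let p0 : (p%:R : K) != 0 := inv_notin_neq0 localization_pV.

(** A crude upper bound in the role of the ramification index: elements of [K] have annihilators of
    size at most dim + 1, and the pigeonhole exponent N is at most p to that size. *)
Definition ramification_bound := (p ^ (\dim {:K}).+1)%N.
Local Notation e := ramification_bound.

Lemma ramification_bound_gt0 : (0 < e)%N.
Proof. by rewrite expn_gt0 prime_gt0. Qed.

Lemma prime_expr_dvd (u : ring_of_integers K) : u \in nfp_ideal P ->
  val u ^+ e / p%:R \in B.
Proof.
move=> uP; have [G [szG G0 Gu]] := number_field_annihilator (val u).
have [N [M [q [leN M0 E]]]] := torsion_modulo_prime p_pr G0 Gu.
have uN := nonunit_p_dvd localization_valuation M0 (localization_nonunit uP)
  (int_poly_mem q (localization_val u)) E.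
have {}leN : (N <= e)%N by apply: leq_trans leN _; rewrite leq_exp2l// prime_gt1.
by rewrite -(subnKC leN) exprD mulrAC rpredM// rpredX// localization_val.
Qed.

(* If z is not in P^(n+1) and y is in P^n but y/z is not in B, then z/y = u/s
   with u in P and s invertible modulo P, so that s z = u y is in P^(n+1). *)
Lemma ideal_power_div (y z : ring_of_integers K) n :
  ideal_power P n y -> ~ ideal_power P n.+1 z -> val y / val z \in B.
Proof.
move=> yP zP; have [y0|y0] := eqVneq (val y) 0.
  by rewrite y0 mul0r rpred0.
have [/BE//|[u [s [uP sP]]]] := localization_dichotomy (val y / val z).
rewrite invf_div => E; case: zP; have [t st] := prime_sub1_inv sP.
apply: (ideal_power_cancel st).
suff -> : s * z = u * y by exact: ideal_powerS.
apply: val_inj; rewrite !rmorphM /=; have s0 := roi_val_neq0 sP.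
have zE : val z = val u / val s * val y by rewrite -E divfK.
by rewrite zE mulrA mulrCA divff// mulr1.
Qed.

(** In each product of n + e m elements of P, the first n are divided by z. The product y2 of the
    others satisfies (y2/p^m)^e = product of the u_j^e/p, which is in [B], and [B] is closed under
    roots. *)
Lemma ideal_power_div_p (y z : ring_of_integers K) n m :
  ideal_power P (n + e * m) y -> ~ ideal_power P n.+1 z ->
  val y / val z / p%:R ^+ m \in B.
Proof.
move=> [l [c [a [aP ->]]]] zP.
rewrite (rmorph_sum valR) !mulr_suml; apply: rpred_sum => i _.
rewrite big_split_ord mulrA rmorphM.
set y1 := c i * _; set y2 := \prod_(j < e * m) _.
have y1z : val y1 / val z \in B.
  apply: (ideal_power_div _ zP).
  exists 1%N, (fun=> c i), (fun=> fun j => a i (lshift _ j)).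
  by split=> //; rewrite big_ord1.
suff y2m : val y2 / p%:R ^+ m \in B.
  by rewrite [X in X / _ ^+ _]mulrAC -(mulrA (_ / _)) rpredM.
apply: (valuation_subring_root localization_valuation ramification_bound_gt0).
have -> : (val y2 / p%:R ^+ m) ^+ e =
    \prod_(j < e * m) (val (a i (rshift n j)) ^+ e / p%:R).
  rewrite big_split /= prodr_const card_ord prodrXl -(rmorph_prod valR).
  by rewrite exprMn exprVn -exprM exprVn mulnC.
by rewrite rpred_prod// => j _; exact: prime_expr_dvd.
Qed.

Lemma integer_valuationP (y : ring_of_integers K) : y != 0 ->
  ideal_power P (integer_valuation P y) y /\
  ~ ideal_power P (integer_valuation P y).+1 y.
Proof.
move=> y0; rewrite /integer_valuation.
apply: (@xgetPex _ 0%N [set n | ideal_power P n y /\ ~ ideal_power P n.+1 y]).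
have [N yN] : exists N, ~ ideal_power P N y.
  apply: contrapT => yP; case/eqP: y0; apply: val_inj; rewrite rmorph0.
  have [G [_ G0 Gy]] := number_field_annihilator (val y).
  have {}G0 : G != 0 by apply: contraNneq G0 => ->; rewrite map_poly0.
  apply: (padic_separated p_pr localization_pV G0 Gy) => n.
  (* Dividing by z = 1, which is not in P^1, shows that an element of all powers of P is divisible
     by all powers of p. *)
  have := @ideal_power_div_p y 1 0 n; rewrite rmorph1 divr1; apply.
    by apply: contrapT => yPn; apply: yP; exists (0 + e * n)%N.
  move=> /(ideal_power_leq (leqnn _)) [l [c [a [aP E]]]].
  have : 1 \in nfp_ideal P; last by apply/negP; exact: prime_notin1.
  by rewrite E rpred_sum// => i _; rewrite big_ord1 idealMr.
elim: N yN => [|N IH] yN; first by case: yN; exact: ideal_power0.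
by have [yN'|/IH//] := pselect (ideal_power P N y); exists N.
Qed.

Lemma prime_valuation_fraction (x : K) : x != 0 ->
  exists (y z : ring_of_integers K), [/\ y != 0, z != 0, x = val y / val z &
    prime_valuation P x =
      EFin ((integer_valuation P y)%:Z - (integer_valuation P z)%:Z)].
Proof.
move=> x0; rewrite /prime_valuation (negPf x0).
set S := [set v : int | _].
have [y [z [y0 z0 xE vE]]] : S (xget 0 S).
  apply: xgetPex; have [u [s [u0 s0 E]]] : exists u s : ring_of_integers K,
      [/\ u != 0, s != 0 & x = val u / val s].
    have val0 (u : ring_of_integers K) : val u != 0 -> u != 0.
      by apply: contra_neq => ->; rewrite rmorph0.
    case: (localization_dichotomy x) => [[u [s [_ E]]]|[u [s [_ _ /(congr1 GRing.inv)]]]].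
      exists u, s; move: x0; rewrite E mulf_eq0 invr_eq0 negb_or => /andP[u0 s0].
      by split=> //; exact: val0.
    rewrite invrK invf_div => E.
    exists s, u; move: x0; rewrite E mulf_eq0 invr_eq0 negb_or => /andP[u0 s0].
    by split=> //; exact: val0.
  by exists ((integer_valuation P u)%:Z - (integer_valuation P s)%:Z); exists u, s.
by exists y, z; rewrite -vE.
Qed.

(** This converts the hypothesis on U(n_k) into divisibility by powers of p; the loss of the factor
    e is harmless because the valuations tend to infinity. *)
Lemma prime_valuation_ge (x : K) m :
  (((e * m)%:Z)%:E <= prime_valuation P x)%E -> x / p%:R ^+ m \in B.
Proof.
have [->|x0] := eqVneq x 0; first by rewrite mul0r rpred0.
have [y [z [y0 z0 -> ->]]] := prime_valuation_fraction x0.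
rewrite lee_fin => le_m.
have [yP _] := integer_valuationP y0; have [_ zP] := integer_valuationP z0.
apply: (@ideal_power_div_p y z (integer_valuation P z)) => //.
by apply: ideal_power_leq yP; lia.
Qed.

Lemma prime_valuation_ge0 (x : K) : (0%:E <= prime_valuation P x)%E -> x \in B.
Proof.
by move=> x0; rewrite -[x]divr1 -(expr0 p%:R) prime_valuation_ge// muln0.
Qed.

Lemma prime_valuation_eq0 (x : K) :
  prime_valuation P x = 0%:E%E -> x != 0 /\ x^-1 \in B.
Proof.
have [->|x0] := eqVneq x 0; first by rewrite /prime_valuation eqxx.
have [y [z [y0 z0 -> ->]]] := prime_valuation_fraction x0.
case=> vE; split=> //; rewrite invf_div.
have [_ yP] := integer_valuationP y0; have [zP _] := integer_valuationP z0.
by apply: ideal_power_div yP; apply: ideal_power_leq zP; lia.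
Qed.

End LocalRing.

(** * Binet expansions *)

Section ShiftAction.
Variable F : fieldType.
Implicit Types (p q g : {poly F}) (u v : int -> F) (n : int).

(** The module structure on two-sided sequences in which 'X acts as the shift; recurrences become
    annihilating polynomials. *)
Definition shift_act q u n : F := \sum_(i < size q) q`_i * u (n + i%:Z).

Lemma shift_act_wide m q u n : (size q <= m)%N ->
  shift_act q u n = \sum_(i < m) q`_i * u (n + i%:Z).
Proof.
move=> szq; rewrite /shift_act (big_ord_widen _ (fun i : nat => q`_i * u (n + i%:Z)) szq).
rewrite big_mkcond; apply: eq_bigr => i _; case: ltnP => // le_i.
by rewrite nth_default// mul0r.
Qed.

Lemma shift_act_eq q u v n : u =1 v -> shift_act q u n = shift_act q v n.
Proof. by move=> uv; apply: eq_bigr => i _; rewrite uv. Qed.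

Lemma shift_act0 u n : shift_act 0 u n = 0.
Proof. by rewrite /shift_act size_poly0 big_ord0. Qed.

Lemma shift_actD p q u n : shift_act (p + q) u n = shift_act p u n + shift_act q u n.
Proof.
rewrite !(@shift_act_wide (maxn (size p) (size q)))// ?leq_maxl ?leq_maxr//;
  last exact: size_polyD.
by rewrite -big_split; apply: eq_bigr => i _; rewrite coefD mulrDl.
Qed.

Lemma shift_actMX q u n : shift_act (q * 'X) u n = shift_act q u (n + 1).
Proof.
rewrite (@shift_act_wide (size q).+1); last first.
  by have [->|q0] := eqVneq q 0; rewrite ?mul0r ?size_poly0// size_mulX.
rewrite big_ord_recl coefMX /= mul0r add0r; apply: eq_bigr => i _.
by rewrite coefMX /=; congr (_ * u _); rewrite /bump /=; lia.
Qed.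

Lemma shift_actZ a q u n : shift_act (a *: q) u n = a * shift_act q u n.
Proof.
rewrite (@shift_act_wide (size q)) ?size_scale_leq// mulr_sumr.
by apply: eq_bigr => i _; rewrite coefZ mulrA.
Qed.

Lemma shift_actC c u n : shift_act c%:P u n = c * u n.
Proof.
rewrite (@shift_act_wide 1%N) ?size_polyC_leq1// big_ord1 coefC eqxx.
by rewrite addr0.
Qed.

Lemma shift_actM p q u n : shift_act (p * q) u n = shift_act p (shift_act q u) n.
Proof.
elim/poly_ind: p n => [|p c IH] n; first by rewrite mul0r !shift_act0.
rewrite mulrDl shift_actD mulrAC shift_actMX IH mul_polyC shift_actZ.
by rewrite shift_actD shift_actMX shift_actC.
Qed.

Lemma shift_act_zero q u n : u =1 (fun=> 0) -> shift_act q u n = 0.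
Proof.
by move=> u0; rewrite /shift_act big1// => i _; rewrite u0 mulr0.
Qed.

Lemma shift_actB q u v n :
  shift_act q (fun k => u k - v k) n = shift_act q u n - shift_act q v n.
Proof. by rewrite -sumrB; apply: eq_bigr => i _; rewrite mulrBr. Qed.

Lemma shift_act_sum (I : Type) (r : seq I) q (w : I -> int -> F) n :
  shift_act q (fun k => \sum_(i <- r) w i k) n = \sum_(i <- r) shift_act q (w i) n.
Proof.
rewrite /shift_act exchange_big; apply: eq_bigr => i _.
by rewrite mulr_sumr.
Qed.

Lemma shift_act_XsubC z u n : shift_act ('X - z%:P) u n = u (n + 1) - z * u n.
Proof.
rewrite -[X in X - _]mul1r -polyCN shift_actD shift_actMX -polyC1 !shift_actC.
by rewrite mul1r mulNr.
Qed.

Lemma shift_act_gcd p q u : shift_act p u =1 (fun=> 0) ->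
  shift_act q u =1 (fun=> 0) -> shift_act (gcdp p q) u =1 (fun=> 0).
Proof.
move=> pu qu n; have [[a b] /= ab] := Bezoutp p q.
have [[c d] /= /andP[c0 d0] E] := eqpP _ _ ab.
have := congr1 (fun r => shift_act r u n) E.
rewrite !shift_actZ shift_actD !shift_actM (shift_act_zero _ _ pu).
rewrite (shift_act_zero _ _ qu) addr0 mulr0.
by move=> /esym/eqP; rewrite mulf_eq0 (negPf d0) => /eqP.
Qed.

(** The leading coefficient 1 propagates m consecutive zeros forward, the nonzero constant
    coefficient backward. *)
Lemma recurrence_zero g m v : size g = m.+1 -> g`_m = 1 -> g`_0 != 0 ->
  shift_act g v =1 (fun=> 0) -> (forall i : 'I_m, v i%:Z = 0) -> v =1 (fun=> 0).
Proof.
move=> szg gm g0 gv v0.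
have step n : (forall i : 'I_m, v (n + i%:Z) = 0) -> v (n + m%:Z) = 0.
  move=> vn; have := gv n; rewrite (shift_act_wide _ _ (_ : (size g <= m.+1)%N)) ?szg//.
  by rewrite big_ord_recr /= big1 ?add0r ?gm ?mul1r// => i _; rewrite vn mulr0.
have back n : (forall i : 'I_m, v (n + 1 + i%:Z) = 0) -> v n = 0.
  move=> vn; have := gv n; rewrite (shift_act_wide _ _ (_ : (size g <= m.+1)%N)) ?szg//.
  rewrite big_ord_recl /= addr0 big1 ?addr0 => [/eqP|i _].
    by rewrite mulf_eq0 (negPf g0) => /eqP.
  rewrite (_ : n + (bump 0 i)%:Z = n + 1 + i%:Z) ?vn ?mulr0//.
  by rewrite /bump /=; lia.
have W n : forall i : 'I_m, v (n + i%:Z) = 0.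
  elim/int_ind: n => [|n IH|n IH] i; first by rewrite add0r.
    have [lt_i|le_i] := ltnP i.+1 m.
      by rewrite (_ : _ + _ = n%:Z + (Ordinal lt_i)%:Z) ?IH//=; lia.
    rewrite (_ : _ + _ = n%:Z + m%:Z) ?step//; have := ltn_ord i; lia.
  case: i => -[|i] lt_i /=.
    by rewrite addr0; apply: back => i; rewrite (_ : _ + _ = - n%:Z + i%:Z) ?IH//; lia.
  have lt_i' : (i < m)%N by exact: ltnW.
  by rewrite (_ : _ + _ = - n%:Z + (Ordinal lt_i')%:Z) ?IH//=; lia.
move=> n; case: (posnP m) => [m0|m0]; last by rewrite -[n]addr0 (W n (Ordinal m0)).
have -> : n = n + m%:Z by rewrite m0 addr0.
by apply: step => -[i lt_i]; exfalso; rewrite m0 in lt_i.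
Qed.

(** The shift is invertible on sequences indexed by [int], so factors 'X can be cancelled from an
    annihilator. *)
Lemma shift_act_nonzero_constant q u : q != 0 -> shift_act q u =1 (fun=> 0) ->
  exists q', [/\ (size q' <= size q)%N, q'`_0 != 0 & shift_act q' u =1 (fun=> 0)].
Proof.
elim/poly_ind: q => [|q c IH]; first by rewrite eqxx.
have [->|c0] := eqVneq c 0; last first.
  by exists (q * 'X + c%:P); split; rewrite // coefD coefMX coefC add0r.
rewrite addr0 => qX0 qu; have q0 : q != 0 by apply: contraNneq qX0 => ->; rewrite mul0r.
have [n|q' [szq' q'0 q'u]] := IH q0; first by rewrite -(subrK 1 n) -shift_actMX.
by exists q'; split=> //; rewrite size_mulX// ltnW.
Qed.

End ShiftAction.

(** * The order of a recurrence, over the base field and over extensions *)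

Section LinearRecurrence.
Variables (K : fieldType) (U : linear_recurrence K).
Local Notation m := (lrs_order U).

Lemma lrs_poly_tail_size :
  (size (\sum_(i < m) lrs_coef i *: 'X^i)%R <= m)%N.
Proof.
apply: (leq_trans (size_sum _ _ _)); apply/bigmax_leqP => i _.
by rewrite (leq_trans (size_scale_leq _ _))// size_polyXn.
Qed.

Lemma size_lrs_poly : size (lrs_poly U) = m.+1.
Proof.
by rewrite size_polyDl ?size_polyXn// size_polyN ltnS lrs_poly_tail_size.
Qed.

Lemma monic_lrs_poly : lrs_poly U \is monic.
Proof.
rewrite monicE lead_coefDl ?lead_coefXn//.
by rewrite size_polyN size_polyXn ltnS lrs_poly_tail_size.
Qed.

Lemma coef_lrs_poly (i : 'I_m) : (lrs_poly U)`_i = - lrs_coef i.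
Proof.
rewrite coefB coefXn ltn_eqF// sub0r coef_sum (bigD1 i)//= coefZ coefXn eqxx mulr1.
rewrite big1 ?addr0// => j ji; rewrite coefZ coefXn [_ == _](_ : _ = false) ?mulr0//.
by apply: contraNF ji => /eqP/ord_inj ->.
Qed.

Lemma lrs_poly_act : shift_act (lrs_poly U) U =1 (fun=> 0).
Proof.
move=> n; rewrite (shift_act_wide _ _ (eq_leq size_lrs_poly)) big_ord_recr /=.
have -> : (lrs_poly U)`_m = 1.
  by have := monicP monic_lrs_poly; rewrite /lead_coef size_lrs_poly.
rewrite mul1r (lrs_rec U) -big_split big1// => i _ /=.
by rewrite coef_lrs_poly mulNr addNr.
Qed.

Lemma lrs_poly_coef0 : (lrs_poly U)`_0 != 0.
Proof.
have [m0|m0] := posnP m.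
  have := monicP monic_lrs_poly; rewrite /lead_coef size_lrs_poly m0 /= => ->.
  exact: oner_neq0.
by rewrite -[0%N]/(nat_of_ord (Ordinal m0)) coef_lrs_poly oppr_eq0 lrs_coef0.
Qed.

Lemma lrs_order_min (q : {poly K}) :
  q != 0 -> shift_act q U =1 (fun=> 0) -> (m < size q)%N.
Proof.
move=> q0 /(shift_act_nonzero_constant q0)[r [szr r0 ru]].
apply: leq_trans szr; have sr : (0 < size r)%N.
  by rewrite size_poly_gt0; apply: contraNneq r0 => ->; rewrite coef0.
rewrite -(prednK sr) ltnS.
have lr0 : lead_coef r != 0 by rewrite lead_coef_eq0 -size_poly_gt0.
apply: (@lrs_min _ U _ (fun i => - r`_i / lead_coef r)) => [i ->|n].
  by rewrite mulf_neq0 ?oppr_eq0 ?invr_eq0.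
have szr' : (size r <= (size r).-1.+1)%N by rewrite prednK.
have := ru n; rewrite (shift_act_wide _ _ szr') big_ord_recr /=.
rewrite -/(lead_coef r) addrC => /eqP; rewrite addr_eq0 => /eqP E.
apply: (mulfI lr0); rewrite E mulr_sumr -sumrN; apply: eq_bigr => i _.
by rewrite mulrA -mulNr mulrCA divff ?mulr1.
Qed.

(* A relation of order at most m over the extension makes the Hankel determinant
   of U vanish, and then there is such a relation over K. *)
Lemma lrs_order_min_ext (L : fieldType) (iota : {rmorphism K -> L}) (q : {poly L}) :
  q != 0 -> shift_act q (fun n => iota (U n)) =1 (fun=> 0) -> (m < size q)%N.
Proof.
move=> q0 qu; rewrite ltnNge; apply/negP => szq.
pose H := \matrix_(i < m, j < m) U (j%:Z + i%:Z).
have : \det (map_mx iota H) == 0.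
  apply/det0P; exists (poly_rV q).
    by apply: contraNneq q0 => q0; rewrite -(poly_rV_K szq) q0 linear0.
  apply/rowP => j; rewrite !mxE -[RHS](qu j%:Z) (shift_act_wide _ _ szq).
  by apply: eq_bigr => i _; rewrite !mxE.
rewrite det_map_mx fmorph_eq0 => /det0P[c c0 cH].
have rc0 : rVpoly c != 0 by apply: contraNneq c0 => rc; rewrite -[c]rVpolyK rc linear0.
have := @lrs_order_min (rVpoly c) rc0; rewrite ltnNge size_poly.
move=> /(_ _)/negP; apply => //.
(* The kernel vector c gives a combination of shifts of U that vanishes at m consecutive places; it
   inherits the recurrence of U, so it vanishes everywhere. *)
apply: (recurrence_zero size_lrs_poly _ lrs_poly_coef0).
- by have := monicP monic_lrs_poly; rewrite /lead_coef size_lrs_poly.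
- by move=> n; rewrite -shift_actM mulrC shift_actM shift_act_zero//; exact: lrs_poly_act.
move=> j; have /rowP/(_ j) := cH; rewrite !mxE => <-.
rewrite (shift_act_wide _ _ (size_poly _ _)); apply: eq_bigr => i _.
by rewrite coef_rVpoly_ord mxE.
Qed.

End LinearRecurrence.

(** * Polynomials times exponentials, and the Binet expansion *)

Section ExponentialPolynomials.
Variable F : fieldType.
Hypothesis char0 : forall n, n.+1%:R != 0 :> F.
Implicit Types (f g q : {poly F}) (r z : F).

Definition expo_poly f r (n : int) : F := f.[n%:~R] * r ^ n.

(** The polynomial factor that results when the shift minus z is applied to f(n) r^n. *)
Definition twisted_diff r z f := r *: (f \Po ('X + 1)) - z *: f.

Lemma twisted_diffD r z f g :
  twisted_diff r z (f + g) = twisted_diff r z f + twisted_diff r z g.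
Proof.
by rewrite /twisted_diff comp_polyD !scalerDr opprD addrACA.
Qed.

Lemma coef_twisted_diffZXn r z c k i :
  (twisted_diff r z (c *: 'X^k))`_i = c * (r *+ 'C(k, i) - z *+ (i == k)).
Proof.
rewrite /twisted_diff coefB !coefZ comp_polyZ coefZ comp_Xn_poly exprDn coef_sum coefXn.
have -> : \sum_(j < k.+1) ('X^(k - j) * 1 ^+ j *+ 'C(k, j) : {poly F})`_i = 'C(k, i)%:R.
  rewrite (reindex_inj rev_ord_inj) /=.
  under eq_bigr do rewrite expr1n mulr1 coefMn coefXn subSS subKn -1?ltnS//.
  under eq_bigr do rewrite bin_sub -1?ltnS//.
  have [lt_ki|le_ik] := ltnP k i.
    rewrite bin_small// big1// => j _; rewrite gtn_eqF ?mul0rn//.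
    by apply: leq_trans lt_ki; rewrite ltn_ord.
  rewrite (bigD1 (Ordinal (le_ik : i < k.+1)%N))//= eqxx big1 ?addr0// => j ji.
  rewrite [_ == _](_ : _ = false) ?mul0rn//.
  by apply: contraNF ji => /eqP E; apply/eqP/val_inj.
by rewrite -[r *+ _]mulr_natr -[z *+ _]mulr_natr; ring.
Qed.

(** Leading terms are removed one by one. For z different from r the operator keeps degrees and
    multiplies leading coefficients by r - z. For z = r it lowers degrees by one, so 'X^k is reached
    from 'X^(k+1), with the factor r (k+1), nonzero in characteristic 0. *)
Lemma twisted_diff_surj r z g : r != 0 -> exists f, twisted_diff r z f = g.
Proof.
move=> r0; have [n] := ubnP (size g).
elim: n g => // n IH g; rewrite ltnS => szg.
have [m [c [cE mP]]] : exists m c, (twisted_diff r z (c *: 'X^m))`_n.-1 = g`_n.-1 /\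
    forall i, (n.-1 < i)%N -> (twisted_diff r z (c *: 'X^m))`_i = 0.
  have [->|rz] := eqVneq z r.
    exists n.-1.+1, (g`_n.-1 / (r * n.-1.+1%:R)); split.
      rewrite coef_twisted_diffZXn binSn ltn_eqF// mulr0n subr0 -[r *+ _]mulr_natr.
      by rewrite divfK// mulf_neq0.
    move=> i lt_i; rewrite coef_twisted_diffZXn.
    have [->|ne] := eqVneq i n.-1.+1; first by rewrite binn subrr mulr0.
    by rewrite bin_small ?subrr ?mulr0// ltn_neqAle eq_sym ne.
  exists n.-1, (g`_n.-1 / (r - z)); split.
    by rewrite coef_twisted_diffZXn binn eqxx divfK// subr_eq0 eq_sym.
  by move=> i lt_i; rewrite coef_twisted_diffZXn bin_small// gtn_eqF// subrr mulr0.
case: n szg IH cE mP => [|n] szg IH /= cE mP.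
  exists 0; have -> : g = 0 by apply/eqP; rewrite -size_poly_eq0 -leqn0.
  by rewrite /twisted_diff comp_poly0 !scaler0 subrr.
have [|f fE] := IH (g - twisted_diff r z (c *: 'X^m)).
  rewrite ltnS; apply/leq_sizeP => i le_i; rewrite coefB.
  have [<-|ne] := eqVneq n i; first by rewrite cE subrr.
  have lt_i : (n < i)%N by rewrite ltn_neqAle ne.
  by rewrite mP// (leq_sizeP _ _ szg)// subrr.
by exists (f + c *: 'X^m); rewrite twisted_diffD fE subrK.
Qed.

Lemma size_twisted_diff r f n : (size f <= n.+1)%N -> (size (twisted_diff r r f) <= n)%N.
Proof.
move=> szf; apply/leq_sizeP => i le_ni.
rewrite -[f]coefK poly_def.
have -> : twisted_diff r r (\sum_(k < size f) f`_k *: 'X^k) =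
    \sum_(k < size f) twisted_diff r r (f`_k *: 'X^k).
  elim/big_ind2: _ => [|f1 f2 g1 g2 <- <-|//].
    by rewrite /twisted_diff comp_poly0 subrr.
  exact: twisted_diffD.
rewrite coef_sum big1// => k _; rewrite coef_twisted_diffZXn.
have : (k <= i)%N by have := ltn_ord k; lia.
rewrite leq_eqVlt => /orP[/eqP ->|lt_ki]; first by rewrite binn eqxx subrr mulr0.
by rewrite bin_small// gtn_eqF// subrr mulr0.
Qed.

Lemma shift_act_expo_poly f r z n : r != 0 ->
  shift_act ('X - z%:P) (expo_poly f r) n = expo_poly (twisted_diff r z f) r n.
Proof.
move=> r0; rewrite shift_act_XsubC /expo_poly /twisted_diff.
rewrite hornerD hornerN !hornerZ horner_comp hornerD hornerX hornerC.
by rewrite intrD expfzDr// expr1z; ring.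
Qed.

Lemma shift_act_expo_poly_kill f r n : r != 0 ->
  shift_act (('X - r%:P) ^+ size f) (expo_poly f r) n = 0.
Proof.
move=> r0; have := leqnn (size f); move: {2 3}(size f) => m.
elim: m f n => [|m IH] f n szf.
  move: szf; rewrite leqn0 size_poly_eq0 => /eqP ->.
  by rewrite shift_act_zero// => k; rewrite /expo_poly horner0 mul0r.
rewrite exprSr shift_actM (shift_act_eq _ _ (fun k => shift_act_expo_poly f r k r0)).
by apply: IH; exact: size_twisted_diff.
Qed.

Lemma first_order_recurrence (v : int -> F) z n : z != 0 ->
  (forall k, v (k + 1) = z * v k) -> v n = v 0 * z ^ n.
Proof.
move=> z0 vS; elim/int_ind: n => [|n IH|n IH]; first by rewrite expr0z mulr1.
  by rewrite -addn1 PoszD vS IH expfzDr// expr1z; ring.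
apply: (mulfI z0); rewrite -vS (_ : - n.+1%:Z + 1 = - n%:Z) ?IH; last by lia.
by rewrite (_ : - n%:Z = - n.+1%:Z + 1) ?expfzDr ?expr1z//; [ring | lia].
Qed.

(** The shift minus z leaves a sequence expanded over the tail of the list. Solving [twisted_diff]
    termwise gives a particular solution, and the difference v satisfies v(n+1) = z v(n). A repeated
    root falls under the case r = z of [twisted_diff_surj]. *)
Lemma binet_exists (s : seq F) (u : int -> F) : 0 \notin s ->
  shift_act (\prod_(z <- s) ('X - z%:P)) u =1 (fun=> 0) ->
  exists f : F -> {poly F}, forall n, u n = \sum_(z <- undup s) expo_poly (f z) z n.
Proof.
elim: s u => [|z s IH] u.
  rewrite big_nil => _ u0; exists (fun=> 0) => n; rewrite big_nil -[RHS](u0 n).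
  by rewrite -polyC1 shift_actC mul1r.
rewrite inE negb_or eq_sym => /andP[z0 s0]; rewrite big_cons mulrC => zsu.
have [||g gE] := IH (shift_act ('X - z%:P) u) => //.
  by move=> n; rewrite -shift_actM zsu.
have r0 r : r \in undup s -> r != 0.
  by rewrite mem_undup => rs; apply: contraNneq s0 => <-.
have /choice[h hE] : forall r, exists f, r != 0 -> twisted_diff r z f = g r.
  move=> r; have [r00|/(@twisted_diff_surj _ z (g r))[f fE]] := eqVneq r 0.
    by exists 0.
  by exists f.
pose v n := u n - \sum_(r <- undup s) expo_poly (h r) r n.
have vS n : v (n + 1) = z * v n.
  apply/eqP; rewrite -subr_eq0 -shift_act_XsubC /v shift_actB gE shift_act_sum.
  rewrite subr_eq0; apply/eqP/eq_big_seq => r rs.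
  by rewrite shift_act_expo_poly ?r0// hE ?r0.
have uE n : u n = \sum_(r <- undup s) expo_poly (h r) r n + v 0 * z ^ n.
  by rewrite -first_order_recurrence// /v addrC subrK.
(* If z is not in [s], the value [h z] is unrelated to u and must be discarded. *)
exists (fun r => (if r \in s then h r else 0) + (if r == z then (v 0)%:P else 0)) => n.
have expoD f g' r : expo_poly (f + g') r n = expo_poly f r n + expo_poly g' r n.
  by rewrite /expo_poly hornerD mulrDl.
under eq_bigr do rewrite expoD.
rewrite big_split uE /=; congr (_ + _).
  have -> : \sum_(r <- undup s) expo_poly (h r) r n =
      \sum_(r <- undup s) expo_poly (if r \in s then h r else 0) r n.
    by apply: eq_big_seq => r; rewrite mem_undup => ->.
  case: ifP => [//|zs]; rewrite big_cons zs.
  by rewrite {2}/expo_poly horner0 mul0r add0r.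
have zin : z \in undup (z :: s) by rewrite mem_undup mem_head.
rewrite -[if _ then _ else _]/(undup (z :: s)) (bigD1_seq z zin (undup_uniq _)) /=.
rewrite eqxx big1 ?addr0 => [|r /negPf ->]; first by rewrite /expo_poly hornerC.
by rewrite /expo_poly horner0 mul0r.
Qed.

End ExponentialPolynomials.

Lemma binet_expansion_exists (K : fieldType) (L : closedFieldType)
    (iota : {rmorphism K -> L}) (U : linear_recurrence K) :
  (forall n, n.+1%:R != 0 :> L) ->
  exists (s : nat) (lam : 'I_s -> L) (f : 'I_s -> {poly L}),
    binet_expansion iota U lam f.
Proof.
move=> char0; pose g := map_poly iota (lrs_poly U).
pose u n := iota (U n).
have gu : shift_act g u =1 (fun=> 0).
  move=> n; have := congr1 iota (lrs_poly_act U n); rewrite rmorph0 => <-.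
  rewrite rmorph_sum /= /shift_act size_map_poly; apply: eq_bigr => i _.
  by rewrite coef_map rmorphM.
have [r rE] := closed_field_poly_normal g.
move: rE; rewrite (monicP _) ?scale1r; last by rewrite map_monic monic_lrs_poly.
move=> rE; have rootg x : root g x = (x \in r) by rewrite rE root_prod_XsubC.
have r0 : 0 \notin r.
  by rewrite -rootg rootE horner_coef0 coef_map fmorph_eq0 lrs_poly_coef0.
have [|f fE] := binet_exists char0 r0 (_ : shift_act _ u =1 _); first by rewrite -rE.
pose R := in_tuple (undup r).
exists (size (undup r)), (tnth R), (fun i => f (tnth R i)); split.
- by apply/tuple_uniqP; exact: undup_uniq.
- move=> x; rewrite -/g rootg -mem_undup -[undup r]/(tval R).
  split=> [/tnthP[i ->]|[i ->]]; [by exists i | exact: mem_tnth].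
- move=> i; apply/negP => /eqP fi0.
  (* As f_i = 0, the factor of [h] at lam_i has exponent 0, so lam_i is not a root of [h]. But
     gcd(g, h) annihilates U, so by minimality over L it is g up to a scalar, and lam_i is a root of
     g. *)
  pose h := \prod_(z <- undup r) ('X - z%:P) ^+ size (f z).
  have hu : shift_act h u =1 (fun=> 0).
    move=> n; rewrite (shift_act_eq _ _ fE) shift_act_sum big_seq big1// => z zr.
    rewrite /h (bigD1_seq z)//= ?undup_uniq// mulrC shift_actM.
    apply: shift_act_zero => k; apply: shift_act_expo_poly_kill.
    by apply: contraNneq r0 => <-; rewrite -mem_undup.
  have g0 : g != 0 by rewrite map_poly_eq0 monic_neq0// monic_lrs_poly.
  have du := shift_act_gcd gu hu; set d := gcdp g h in du.
  have d0 : d != 0 by rewrite gcdp_eq0 (negPf g0).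
  have := lrs_order_min_ext d0 du; rewrite -size_lrs_poly -(size_map_poly iota) -/g.
  move=> szd; have dg : d %| g := dvdp_gcdl g h.
  have : d %= g by rewrite -dvdp_size_eqp// eqn_leq szd dvdp_leq.
  rewrite eqp_sym => /andP[gd _].
  have : root h (tnth R i).
    apply: root_dvdp (dvdp_trans gd (dvdp_gcdr g h)) _.
    by rewrite rootg -mem_undup -[undup r]/(tval R) mem_tnth.
  rewrite /h rootE horner_prod prodf_seq_eq0 => /hasP[z _ /=].
  rewrite horner_exp hornerXsubC expf_eq0 subr_eq0 => /andP[+ /eqP zE].
  by rewrite -zE fi0 size_poly0.
- move=> n; rewrite -/(u n) fE big_tnth /expo_poly.
  by apply: eq_bigr => i _; rewrite (tnth_nth 0).
Qed.

(** * The p-adic limit *)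

(** The exponent M + 1 keeps the valuation positive even for M = 0, so p does not divide the
    denominator of n - a, which the denominator of a divides. *)
Lemma padic_valuation_sub_ge (p : nat) (n : int) (a : rat) M : prime p ->
  (((M.+1)%:Z)%:E <= padic_valuation p (n%:~R - a))%E ->
  ~~ (p %| denq a)%Z /\
  exists t : int, n * denq a - numq a = (p ^ M.+1)%:Z * t.
Proof.
move=> p_pr; rewrite /padic_valuation; case: eqVneq => [/eqP|].
  rewrite subr_eq0 => /eqP <- _; rewrite denq_int numq_int mulr1 subrr; split.
    by rewrite dvdz1 absz_nat; case: (p) p_pr => [|[]].
  by exists 0; rewrite mulr0.
set r := n%:~R - a => r0; rewrite lee_fin => valr.
have pnum : (p %| numq r)%Z.
  rewrite dvdzE absz_nat -[X in (X %| _)%N]expn1 pfactor_dvdn ?absz_gt0 ?numq_eq0//; lia.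
have cop : coprime `|numq r| `|denq r| := coprime_num_den r.
have pNden : ~~ (p %| denq r)%Z.
  apply: contraL cop; rewrite !dvdzE !absz_nat /= in pnum * => pden.
  apply/negP => /eqP g1.
  have : (p %| gcdn `|numq r| `|denq r|)%N by rewrite dvdn_gcd pnum.
  by rewrite g1 dvdn1; case: (p) p_pr => [|[]].
have lden : logn p `|denq r| = 0%N.
  by apply/eqP; rewrite -leqn0 leqNgt logn_gt0 mem_primes p_pr absz_gt0 denq_eq0 /=.
have E : numq r * denq a = (n * denq a - numq a) * denq r.
  apply: (@intr_inj rat); rewrite !intrM rmorphB /= intrM.
  have da : (denq a)%:~R != 0 :> rat by rewrite intr_eq0 denq_eq0.
  have dr : (denq r)%:~R != 0 :> rat by rewrite intr_eq0 denq_eq0.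
  have rE : (numq r)%:~R = r * (denq r)%:~R :> rat by rewrite -{2}[r]divq_num_den divfK.
  have aE : (numq a)%:~R = a * (denq a)%:~R :> rat by rewrite -{2}[a]divq_num_den divfK.
  by rewrite rE aE /r; ring.
split.
  apply: contra pNden => pda.
  have : (denq a %| numq a * denq r)%Z.
    have -> : numq a * denq r = (n * denq r - numq r) * denq a.
      by rewrite [RHS]mulrBl E; ring.
    exact: dvdz_mull.
  rewrite Gauss_dvdzr; last by rewrite coprimezE coprime_sym coprime_num_den.
  exact: dvdz_trans.
have /dvdzP[t ->] : ((p ^ M.+1)%:Z %| n * denq a - numq a)%Z; last first.
  by exists t; rewrite mulrC.
have cp : coprimez (p ^ M.+1)%:Z (denq r).
  by rewrite coprimezE absz_nat coprimeXl// prime_coprime.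
rewrite -(Gauss_dvdzl _ cp) -E dvdz_mulr// dvdzE absz_nat.
by rewrite pfactor_dvdn ?absz_gt0 ?numq_eq0//; lia.
Qed.

Section Units.
Variables (F : fieldType) (A : subringClosed F).

Lemma exprz_mem (x : F) (n : int) : x \in A -> x^-1 \in A -> x ^ n \in A.
Proof.
by move=> xA xVA; case: n => k; [exact: rpredX | rewrite NegzE -exprnN -exprVn rpredX].
Qed.

Lemma horner_sub_mem (g : {poly F}) (x y d : F) : g \is a polyOver A ->
  x \in A -> y \in A -> (x - y) / d \in A -> (g.[x] - g.[y]) / d \in A.
Proof.
move=> gA xA yA xy; rewrite !horner_coef -sumrB mulr_suml rpred_sum// => i _.
rewrite -mulrBr -mulrA rpredM ?(polyOverP gA)// subrXX mulrAC rpredM//.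
by rewrite rpred_sum// => j _; rewrite rpredM ?rpredX.
Qed.

Hypothesis valA : valuation_subring A.

Lemma valuation_subring_coprime_inv (p : nat) (c : int) :
  prime p -> (p%:R)^-1 \notin A -> ~~ (p %| c)%Z -> (c%:~R)^-1 \in A.
Proof.
move=> p_pr pVA pNc; have [u [v uv1]] := Bezout_prime F p_pr pNc.
apply: contraFT (nonunit1 A) => cVA; rewrite uv1.
by rewrite nonunitD// nonunitM ?rpred_int// /nonunit ?cVA ?pVA orbT.
Qed.

(** A coefficient x outside [A] has 1/x in [A], which clears it; D is the product of these over all
    coefficients. *)
Lemma common_denominator (s : nat) (f : 'I_s -> {poly F}) :
  exists D : F, [/\ D != 0, D \in A & forall i, D *: f i \is a polyOver A].
Proof.
have /choice[d dP] : forall x : F, exists d, [/\ d != 0, d \in A & d * x \in A].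
  move=> x; have [xA|xA] := boolP (x \in A).
    by exists 1; rewrite oner_neq0 mul1r rpred1.
  have x0 : x != 0 by apply: contraNneq xA => ->; rewrite rpred0.
  exists x^-1; rewrite invr_eq0 mulVf// rpred1; split=> //.
  by have [/(negP xA)|] := valA x.
pose D := \prod_i \prod_(x <- (f i : seq F)) d x.
exists D; split.
- apply/prodf_neq0 => i _; rewrite prodf_seq_neq0; apply/allP => x _ /=.
  by have [] := dP x.
- by rewrite rpred_prod// => i _; rewrite rpred_prod// => x _; have [] := dP x.
move=> i; apply/polyOverP => k; rewrite coefZ.
have [lt_k|le_k] := ltnP k (size (f i)); last by rewrite nth_default// mulr0 rpred0.
rewrite /D (bigD1 i)//= (big_rem (f i)`_k) ?mem_nth//= -!mulrA [X in _ * X]mulrA.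
rewrite [X in _ * X]mulrC mulrA rpredM//; first by have [] := dP (f i)`_k.
rewrite rpredM// rpred_prod// => j _; first by have [] := dP j.
by rewrite rpred_prod// => x _; have [] := dP x.
Qed.

End Units.

Lemma padic_limit_twisted_zero (L : closedFieldType) (A : subringClosed L)
    (p s : nat) (lam : 'I_s -> L) (f : 'I_s -> {poly L}) (a : rat)
    (n : nat -> int) :
  valuation_subring A -> (p%:R)^-1 \notin A -> prime p ->
  (forall x : L, exists G : {poly int}, map_poly (intr : int -> 'F_p) G != 0 /\
    root (map_poly intr G) x) ->
  (forall i, [/\ lam i != 0, lam i \in A & (lam i)^-1 \in A]) ->
  (forall M, exists N, forall k, (N <= k)%N ->
    (\sum_(i < s) (f i).[(n k)%:~R] * lam i ^ n k) / p%:R ^+ M \in A) ->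
  tends_to_infty (fun k => padic_valuation p ((n k)%:~R - a)) ->
  exists d xi : 'I_s -> L,
    [/\ forall i, determination (lam i) a (d i),
        forall i, is_root_of_unity (xi i) &
        \sum_(i < s) xi i * (f i).[ratr a] * d i = 0].
Proof.
move=> valA pVA p_pr alg lamP Ulim alim; have p0 := inv_notin_neq0 pVA.
pose l := `|denq a|%N; have l0 : (0 < l)%N by rewrite absz_gt0 denq_eq0.
have lE : denq a = l%:Z by rewrite /l absz_denq.
have /choice[mu muE] : forall i, exists mu : L, mu ^+ l = lam i.
  move=> i; have /closed_rootP[mu] : size ('X^l - (lam i)%:P) != 1%N.
    by rewrite size_XnsubC// eqSS -lt0n.
  by rewrite rootE hornerD hornerN hornerXn hornerC subr_eq0 => /eqP; exists mu.
have mu0 i : mu i != 0.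
  by have [l0' _ _] := lamP i; rewrite -muE expf_eq0 l0 in l0'.
have muA i : mu i \in A.
  by have [_ + _] := lamP i; rewrite -muE; exact: valuation_subring_root.
have muVA i : (mu i)^-1 \in A.
  by have [_ _] := lamP i; rewrite -muE -exprVn; exact: valuation_subring_root.
have /choice[w wP] := fun i => root_of_unity_approx valA pVA p_pr alg (mu0 i) (muA i) (muVA i).
have /choice[Q0 QP] := wP.
pose Q := (\prod_i Q0 i)%N.
have Qgt0 : (0 < Q)%N by rewrite prodn_gt0// => i; have [] := QP i.
have wQ i : w i ^+ Q = 1.
  have [_ w1 _ _] := QP i; rewrite /Q (bigD1 i)//= exprM w1 expr1n //.
have wA i : w i \in A by have [] := QP i.
have approx M : exists j, forall i (m : int),
    (mu i ^ ((p ^ j)%:Z * m) - w i ^ ((p ^ j)%:Z * m)) / p%:R ^+ M \in A.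
  have /choice[j jP] : forall i, exists j, forall m : int,
      (mu i ^ ((p ^ j)%:Z * m) - w i ^ ((p ^ j)%:Z * m)) / p%:R ^+ M \in A.
    by move=> i; have [_ _ _ /(_ M)] := QP i.
  exists (\sum_i j i)%N => i m; rewrite (bigD1 i)//= expnD PoszM -mulrA; exact: jP.
have {wP}[D [D0 DA DfA]] := common_denominator valA f.
pose S (c : nat) := \sum_(i < s) w i ^+ c * (f i).[ratr a] * mu i ^ numq a.
suff [c Sc] : exists c, S c = 0.
  exists (fun i => mu i ^ numq a), (fun i => w i ^+ c); split=> // i.
    by exists (mu i); rewrite lE -exprnP muE.
  by exists Q => //; apply/unity_rootP; rewrite -exprM mulnC exprM wQ expr1n.
apply: contrapT => S_neq0.
(* If no S c vanishes, each D S c fails to be divisible by some p^(e_c). At M, the sum of the e_c,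
   all Q of them fail at once, so a single large k gives the contradiction. *)
have /choice[e eP] : forall c : 'I_Q, exists e, D * S c / p%:R ^+ e \notin A.
  move=> c; apply: contrapT => SA; apply: S_neq0; exists c.
  have [G [G0 Gx]] := alg (D * S c).
  have {}G0 : G != 0 by apply: contraNneq G0 => ->; rewrite map_poly0.
  have /eqP := padic_separated p_pr pVA G0 Gx (fun m =>
    contrapT (fun h => SA (ex_intro _ m (introN idP h)))).
  by rewrite mulf_eq0 (negPf D0) => /eqP.
pose M := (\sum_c e c)%N.
have [N UN] := Ulim M; have [j jP] := approx M.
(* The power p^j makes mu_i^r close to w_i^r, and p^M makes n_k close to a. *)
have [N' aN] := alim (maxn j M).+1%:Z.
pose k := maxn N N'.
have Uk := UN k (leq_maxl _ _).
have [pNl [t tE]] := padic_valuation_sub_ge p_pr (aN k (leq_maxr _ _)).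
set x := n k in Uk tE.
have lV : (l%:R : L)^-1 \in A.
  by rewrite pmulrn -lE; exact: (valuation_subring_coprime_inv valA p_pr pVA).
have l0L : (l%:R : L) != 0.
  apply: contraNneq pVA => l00; rewrite -[_^-1]mul1r.
  by apply: (subring_divp_Bezout p_pr pNl (rpred1 A)); rewrite lE -pmulrn l00
    mulr0 rpred0.
have aE : ratr a = (numq a)%:~R / l%:R :> L by rewrite /ratr lE pmulrn.
have aA : ratr a \in A by rewrite aE rpredM ?rpred_int.
set r := x * denq a - numq a in tE.
have rpow m : (m <= (maxn j M).+1)%N -> exists t' : int, r = (p ^ m)%:Z * t'.
  move=> /subnKC le_m; exists ((p ^ ((maxn j M).+1 - m))%:Z * t).
  by rewrite mulrA -PoszM -expnD le_m.
have xa : (ratr a - x%:~R) / p%:R ^+ M \in A.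
  have [|t' t'E] := rpow M; first by rewrite leqW// leq_maxr.
  have -> : (ratr a - x%:~R) / p%:R ^+ M = - t'%:~R / l%:R :> L.
    have : (r%:~R : L) = p%:R ^+ M * t'%:~R by rewrite t'E intrM -pmulrn natrX.
    rewrite /r lE rmorphB /= intrM -pmulrn => E.
    have pM0 : (p%:R : L) ^+ M != 0 by rewrite expf_neq0.
    have numE : (numq a)%:~R = x%:~R * l%:R - p%:R ^+ M * t'%:~R :> L by rewrite -E; ring.
    by apply: (mulIf pM0); rewrite divfK// aE numE; field.
  by rewrite mulNr rpredN rpredM ?rpred_int.
(* The exponent r may be negative; its Euclidean remainder is a natural number below Q with the same
   power of w_i. *)
pose c := absz (modz r Q).
have cE : c%:Z = modz r Q by rewrite /c gez0_abs ?modz_ge0 ?eqz_nat -?lt0n.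
have lt_c : (c < Q)%N by rewrite -ltz_nat cE ltz_pmod.
have wc i : w i ^+ c = w i ^ r.
  rewrite (divz_eq r Q) mulrC expfzDr; last first.
    apply/eqP => w0; have := wQ i; rewrite w0 expr0n eqn0Ngt Qgt0 => /eqP.
    by rewrite eq_sym oner_eq0.
  by rewrite -exprz_exp -exprnP wQ exp1rz mul1r -cE.
have lamx i : lam i ^ x = mu i ^ numq a * mu i ^ r.
  by rewrite -muE exprnP exprz_exp -expfzDr// /r addrC subrK lE mulrC.
case/negP: (eP (Ordinal lt_c)).
suff SM : D * S c / p%:R ^+ M \in A.
  have le_e : (e (Ordinal lt_c) <= M)%N by rewrite /M (bigD1 (Ordinal lt_c))//= leq_addr.
  have -> : D * S c / p%:R ^+ e (Ordinal lt_c) =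
      D * S c / p%:R ^+ M * p%:R ^+ (M - e (Ordinal lt_c)).
    apply: (mulIf (_ : p%:R ^+ e (Ordinal lt_c) != 0)); first by rewrite expf_neq0.
    by rewrite divfK ?expf_neq0// -(mulrA (_ / _)) -exprD subnK// divfK ?expf_neq0.
  by rewrite rpredM// rpredX// rpred_nat.
rewrite -[D * S c](subrK (D * \sum_(i < s) (f i).[x%:~R] * lam i ^ x)) mulrDl.
apply: rpredD; last by rewrite -mulrA rpredM.
rewrite -mulrBr -sumrB mulr_sumr mulr_suml rpred_sum// => i _.
have -> : D * (w i ^+ c * (f i).[ratr a] * mu i ^ numq a - (f i).[x%:~R] * lam i ^ x)
    / p%:R ^+ M = mu i ^ numq a * (((D *: f i).[ratr a] - (D *: f i).[x%:~R])
      / p%:R ^+ M * mu i ^ r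
      - (D *: f i).[ratr a] * ((mu i ^ r - w i ^ r) / p%:R ^+ M)).
  by rewrite wc lamx !hornerZ; ring.
have muzA i' (z : int) : mu i' ^ z \in A by exact: exprz_mem.
rewrite rpredM// rpredB// rpredM//.
- by apply: horner_sub_mem => //; rewrite rpred_int.
- by rewrite rpred_horner.
- by have [|t' ->] := rpow j; [rewrite leqW// leq_maxl | exact: jP].
Qed.

Lemma closure_annihilator (K : fieldExtType rat) (L : closedFieldType)
    (iota : {rmorphism K -> L}) (p : nat) (x : L) : prime p ->
  is_algebraic_closure iota ->
  exists G : {poly int}, map_poly (intr : int -> 'F_p) G != 0 /\
    root (map_poly intr G) x.
Proof.
move=> p_pr closureK.
pose phi : {rmorphism rat -> L} := iota \o in_alg K.
have [q q0 qx] := closureK x.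
have /integral_algebraic[g g0 gx] : integralOver phi x.
  apply: integral_root qx _; first by rewrite map_poly_eq0.
  move=> _ /(nthP 0)[i _ <-]; rewrite coef_map /=.
  have [r [r0 _ rx]] := minPoly_rat q`_i.
  apply/integral_algebraic; exists r => //.
  by rewrite map_poly_comp fmorph_root.
by have [G [_ G0 Gx]] := primitive_annihilator p_pr g0 gx; exists G.
Qed.

Theorem theorem3p5 (K : fieldExtType rat) (Kbar : closedFieldType)
  (iota : {rmorphism K -> Kbar}) (closureK : is_algebraic_closure iota)
  (U : linear_recurrence K) (P : number_field_prime K)
  (regP : regular_prime U P)
  (p : nat) (p_prime : prime p) (p_below : p%:R \in nfp_ideal P)
  (a : rat) (n : nat -> int)
  (Un_to_infty : tends_to_infty (fun k => prime_valuation P (U (n k))))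
  (n_to_a : tends_to_infty (fun k => padic_valuation p ((n k)%:~R - a))) :
  twisted_rational_zero iota U a.
Proof.
have char0 k : k.+1%:R != 0 :> Kbar.
  have -> : k.+1%:R = (iota \o in_alg K) k.+1%:R by rewrite rmorph_nat.
  by rewrite fmorph_eq0 pnatr_eq0.
have [B BE] := localization_subring P.
(* The extension to [A] takes place inside one field, so the local ring is first moved into
   [Kbar]. *)
have [B' B'E] : exists B' : subringClosed Kbar,
    forall y, (y \in B') <-> exists2 b, b \in B & y = iota b.
  apply: subring_of_closed; split.
  - by apply/asboolP; exists 1; rewrite ?rpred1 ?rmorph1.
  - move=> _ _ /asboolP[b bB ->] /asboolP[c cB ->]; apply/asboolP.
    by exists (b - c); rewrite ?rpredB ?rmorphB.
  - move=> _ _ /asboolP[b bB ->] /asboolP[c cB ->]; apply/asboolP.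
    by exists (b * c); rewrite ?rpredM ?rmorphM.
have pVB : (p%:R : Kbar)^-1 \notin B'.
  apply/negP => /B'E[b bB /eqP]; rewrite -(rmorph_nat iota) -fmorphV.
  rewrite (inj_eq (fmorph_inj iota)) => /eqP pb.
  by have := localization_pV p_prime p_below BE; rewrite pb bB.
have [A [BA pVA valA]] := valuation_subring_above (rpred_nat B' p) pVB.
have iotaA b : b \in B -> iota b \in A by move=> bB; apply/BA/B'E; exists b.
have [s [lam [f binet]]] := binet_expansion_exists iota U char0.
exists s, lam, f; split=> //; have [_ lamE _ UE] := binet.
apply: (@padic_limit_twisted_zero _ A p s lam f a n) => //.
- by move=> x; exact: closure_annihilator p_prime closureK.
- move=> i; have : root (map_poly iota (lrs_poly U)) (lam i) by apply/lamE; exists i.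
  set g := map_poly _ _ => glam; have [regcoef regcoef0] := regP.
  have g1 : g \is monic by rewrite map_monic monic_lrs_poly.
  have szg : size g = (lrs_order U).+1 by rewrite size_map_poly size_lrs_poly.
  have gA : g \is a polyOver A.
    apply/polyOverP => k; have [lt_k|] := ltnP k (lrs_order U).
      rewrite coef_map /= (coef_lrs_poly (Ordinal lt_k)) rmorphN rpredN iotaA//.
      exact: (prime_valuation_ge0 p_prime p_below BE).
    rewrite leq_eqVlt => /orP[/eqP <-|gt_k]; last by rewrite nth_default ?rpred0// szg.
    by have := monicP g1; rewrite /lead_coef szg /= => ->; exact: rpred1.
  have lamA : lam i \in A := valuation_subring_integral valA g1 gA glam.
  have m0 : (0 < lrs_order U)%N.
    rewrite lt0n; apply: contraTneq glam => m0.
    have /eqP/size_poly1P[c c0 ->] : size g = 1%N by rewrite szg m0.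
    by rewrite rootC.
  have [a00 a0V] := prime_valuation_eq0 p_prime p_below BE (regcoef0 (Ordinal m0) erefl).
  have g0E : g`_0 = - iota (lrs_coef (Ordinal m0)).
    by rewrite coef_map -rmorphN -coef_lrs_poly.
  (* Isolating the constant term of the equation of lam_i gives lam_i h = a_0 with h in [A]; as
     1/a_0 is local, 1/lam_i = h/a_0 lies in [A]. *)
  have := rootP glam; rewrite horner_coef szg big_ord_recl expr0 mulr1 g0E.
  rewrite addrC => /eqP.
  set a0 := lrs_coef _ in a00 a0V *.
  rewrite subr_eq0; under eq_bigr do rewrite exprS mulrCA.
  rewrite -mulr_sumr; set h := \sum_(k < _) _ => /eqP lamh.
  have hA : h \in A.
    by rewrite rpred_sum// => k _; rewrite rpredM ?rpredX//; exact: (polyOverP gA).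
  have a0L : iota a0 != 0 by rewrite fmorph_eq0.
  have lam0 : lam i != 0 by apply: contraNneq a0L => l0; rewrite -lamh l0 mul0r.
  split=> //; have -> : (lam i)^-1 = h * iota a0^-1; last by rewrite rpredM// iotaA.
  by apply: (mulfI lam0); rewrite mulfV// mulrA lamh fmorphV mulfV.
move=> M; have [N UN] := Un_to_infty (ramification_bound K p * M)%:Z.
exists N => k /UN/(prime_valuation_ge p_prime p_below BE)/iotaA.
by rewrite fmorph_div rmorphXn rmorph_nat UE.
Qed.
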